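(* Let $M$ and $N$ be tame persistence modules indexed by $\mathbb{R}$ with persistence diagrams $D,E:\mathbb{R}^2_<\to\mathbb{Z}_{\ge0}$ and $k$-th graded persistence diagrams $D_k,E_k:\mathbb{R}^2_<\to\mathbb{Z}$ for $k\ge1$. Let $K$ be the maximum of the values attained by the rank functions of $M$ and $N$. Then $$W_{1,1}(D,E)\le\sum_{k=1}^K W_{1,1}(D_k,E_k)\le(2K-1)\,W_{1,1}(D,E),$$ and these bounds are sharp.
   Context: Tame persistence modules. Let $F$ be a field and $[m]=\{0<1<\dots<m\}$. A persistence module indexed by a sub-poset $P$ of $(\mathbb{R},\le)$ is a functor from $P$ to finite-dimensional $F$-vector spaces. Given $M'$ indexed by $[m]$, extend it to $\hat M'$ indexed by $[m+1]$ by $\hat M'(m+1)=0$. Given an injective order-preserving $\iota:[m+1]\to\mathbb{R}$, $\overline{M'}$ is the persistence module indexed by $\mathbb{R}$ with $\overline{M'}(a)=\hat M'(i)$, where $i$ is the largest element of $[m+1]$ with $\iota(i)\le a$, and $\overline{M'}(a)=0$ if $a<\iota(0)$, with induced structure maps. A persistence module indexed by $\mathbb{R}$ is tame if it is isomorphic to some $\overline{M'}$ (for some $m$, $M'$, $\iota$). The rank function of a persistence module $M$ is $[a,b]\mapsto\operatorname{rank}M(a\le b)$, $a\le b$. Diagrams. For a poset $P$, $P^2_<$ is the poset of half-open intervals $[a,b)$, $a<b$ in $P$, ordered by inclusion. For $[a,b)\in[m+1]^2_<$ let $\operatorname{Rank}(M')[a,b)=\operatorname{rank}M'(a\le b-1)$,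 and let $\operatorname{Rank}_k(M')[a,b)=1$ if $\operatorname{Rank}(M')[a,b)\ge k$ and $0$ otherwise. Let $\mu$ be the Möbius function of $[m+1]^2_<$ ($\mu[x,x]=1$, $\mu[x,y]=-\sum_{x\le y'<y}\mu[x,y']$ for $x<y$), and $(\mu*h)(x)=\sum_{x\le x'}\mu[x,x']h(x')$. Put $\operatorname{PD}(M')=\mu*\operatorname{Rank}(M')$ and $\operatorname{PD}_k(M')=\mu*\operatorname{Rank}_k(M')$. The persistence diagram (resp. $k$-th graded persistence diagram) of $\overline{M'}$ is the function $\mathbb{R}^2_<\to\mathbb{Z}$ whose value at $[\iota(x),\iota(y))$ is $\operatorname{PD}(M')[x,y)$ (resp. $\operatorname{PD}_k(M')[x,y)$) and which is $0$ elsewhere. The persistence diagram is nonnegative. Wasserstein distance. Identify $[x,y)\in\mathbb{R}^2_<$ with the point $(x,y)\in\mathbb{R}^2$ and let $\Delta=\{(x,x):x\in\mathbb{R}\}$. For finitely supported $D,E:\mathbb{R}^2_<\to\mathbb{Z}_{\ge0}$, a coupling is a map $\gamma:(\mathbb{R}^2_<\cup\Delta)\times(\mathbb{R}^2_<\cup\Delta)\to\mathbb{Z}_{\ge0}$ with $\gamma=0$ on $\Delta\times\Delta$, $D(z)=\sum_{w\in\mathbb{R}^2_<\cup\Delta}\gamma(z,w)$ for all $z\in\mathbb{R}^2_<$, and $E(w)=\sum_{z\in\mathbb{R}^2_<\cup\Delta}\gamma(z,w)$ for all $w\in\mathbb{R}^2_<$. $W_{1,1}(D,E)$ is the infimum over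 couplings $\gamma$ of $\sum_{(z,w)}\gamma(z,w)\|w-z\|_1$. For finitely supported $A,B:\mathbb{R}^2_<\to\mathbb{Z}$, writing $A=A^+-A^-$, $B=B^+-B^-$ with $A^\pm,B^\pm\ge0$ and $A^+,A^-$ (resp. $B^+,B^-$) of disjoint support, $W_{1,1}(A,B):=W_{1,1}(A^++B^-,\,B^++A^-)$. *)

(* Defs.v *)
From HB Require Import structures.
From mathcomp Require Import all_boot all_order all_algebra.
From mathcomp Require Import all_classical all_reals all_analysis.
Import Order.TTheory GRing.Theory Num.Theory.

Set Implicit Arguments.
Unset Strict Implicit.
Unset Printing Implicit Defensive.

Local Open Scope classical_set_scope.
Local Open Scope ring_scope.

(** * Persistence modules *)

Record pmod (d : Order.disp_t) (P : porderType d) (F : fieldType) := PMod {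
  pm_obj :> P -> vectType F;
  pm_map : forall a b : P, (a <= b)%O -> 'Hom(pm_obj a, pm_obj b);
  pm_id : forall (a : P) (aa : (a <= a)%O), pm_map aa = \1%VF;
  pm_comp : forall (a b c : P)
      (ab : (a <= b)%O) (bc : (b <= c)%O) (ac : (a <= c)%O),
    pm_map ac = (pm_map bc \o pm_map ab)%VF
}.
Arguments pm_map {d P F} p {a b}.

Definition pm_rank (d : Order.disp_t) (P : porderType d) (F : fieldType)
    (M : pmod P F) (a b : P) (ab : (a <= b)%O) : nat :=
  \dim (limg (pm_map M ab)).

Definition pm_iso (d : Order.disp_t) (P : porderType d) (F : fieldType)
    (M N : pmod P F) : Prop :=
  exists f : forall a : P, 'Hom(M a, N a),
    (forall a : P, bijective (f a)) /\
    (forall (a b : P) (ab : (a <= b)%O),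
      (f b \o pm_map M ab = pm_map N ab \o f a)%VF).

(** Pullback of a module [M] on [P] along a partial map [f] from [Q] to [P],
    with value the zero space wherever [f] is undefined. *)
Section ExtensionByZero.
Context (d d' : Order.disp_t) (P : porderType d) (Q : porderType d').
Context (F : fieldType) (M : pmod P F).

Definition ext0_obj (o : option P) : vectType F :=
  if o is Some i then M i else 'rV[F]_0.

Definition ext0_map (o1 o2 : option P) :
    (forall i j, o1 = Some i -> o2 = Some j -> (i <= j)%O) ->
    'Hom(ext0_obj o1, ext0_obj o2) :=
  match o1, o2 return
    (forall i j, o1 = Some i -> o2 = Some j -> (i <= j)%O) ->
    'Hom(ext0_obj o1, ext0_obj o2)
  with
  | Some i, Some j => fun le12 => pm_map M (le12 i j erefl erefl)
  | _, _ => fun _ => 0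
  end.

Lemma ext0_map_id (o : option P)
    (le11 : forall i j, o = Some i -> o = Some j -> (i <= j)%O) :
  ext0_map le11 = \1%VF.
Proof.
case: o le11 => [i|] le11 /=; first exact: pm_id.
by apply/lfunP => x; rewrite lfunE /= id_lfunE [x]thinmx0.
Qed.

Lemma ext0_map_comp (o1 o2 o3 : option P)
    (le12 : forall i j, o1 = Some i -> o2 = Some j -> (i <= j)%O)
    (le23 : forall i j, o2 = Some i -> o3 = Some j -> (i <= j)%O)
    (le13 : forall i j, o1 = Some i -> o3 = Some j -> (i <= j)%O) :
  (o1 -> o3 -> o2) ->
  ext0_map le13 = (ext0_map le23 \o ext0_map le12)%VF.
Proof.
case: o1 o2 o3 le12 le23 le13 => [i|] [j|] [k|] le12 le23 le13 /= o123;
  rewrite ?comp_lfun0r ?comp_lfun0l //; first exact: pm_comp.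
by have := o123 isT isT.
Qed.

Context (f : Q -> option P).
Hypothesis f_mono : forall a b i j,
  (a <= b)%O -> f a = Some i -> f b = Some j -> (i <= j)%O.
Hypothesis f_conv : forall a b c : Q,
  (a <= b)%O -> (b <= c)%O -> f a -> f c -> f b.

Definition ext0 : pmod Q F :=
  @PMod _ Q F (fun a => ext0_obj (f a))
    (fun a b ab => ext0_map (fun i j => f_mono ab))
    (fun a _ => ext0_map_id _)
    (fun a b c ab bc _ => ext0_map_comp _ _ _ (f_conv ab bc)).

End ExtensionByZero.

(** [hat M'] extends [M'], indexed by [[m]], to [[m+1]] by zero at [m+1]. *)

Definition hat_index (m : nat) (i : 'I_m.+2) : option 'I_m.+1 := insub (i : nat).

Lemma hat_index_mono (m : nat) (a b : 'I_m.+2) (i j : 'I_m.+1) :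
  (a <= b)%O -> hat_index a = Some i -> hat_index b = Some j -> (i <= j)%O.
Proof.
rewrite /hat_index !leEord; case: insubP => // i' _ ia ab [<-].
by case: insubP => // j' _ jb [<-]; rewrite /= ia jb.
Qed.

Lemma hat_index_conv (m : nat) (a b c : 'I_m.+2) :
  (a <= b)%O -> (b <= c)%O -> hat_index a -> hat_index c -> hat_index b.
Proof.
rewrite /hat_index !leEord => _ bc _; case: insubP => // k cm _ _.
by case: insubP => //; rewrite (leq_ltn_trans bc cm).
Qed.

Definition hat (F : fieldType) (m : nat) (M' : pmod 'I_m.+1 F) :
    pmod 'I_m.+2 F :=
  ext0 M' (@hat_index_mono m) (@hat_index_conv m).

(** The largest [i] with [iota i <= a], if any. *)
Definition bar_index (R : realType) (n : nat) (iota : 'I_n -> R) (a : R) :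
    option 'I_n :=
  [pick i | (iota i <= a) && [forall j, (iota j <= a) ==> (j <= i)%O]].

Lemma bar_index_mono (R : realType) (n : nat) (iota : 'I_n -> R)
    (a b : R) (i j : 'I_n) :
  (a <= b)%O -> bar_index iota a = Some i -> bar_index iota b = Some j ->
  (i <= j)%O.
Proof.
rewrite /bar_index => ab; case: pickP => // i' /andP[ia _] [<-].
case: pickP => // j' /andP[_ /forallP/(_ i')/implyP h] [<-].
exact/h/(le_trans ia).
Qed.

Lemma bar_index_conv (R : realType) (n : nat) (iota : 'I_n -> R) (a b c : R) :
  (a <= b)%O -> (b <= c)%O ->
  bar_index iota a -> bar_index iota c -> bar_index iota b.
Proof.
rewrite /bar_index => ab _; case: pickP => // i /andP[ia _] _ _.
case: pickP => //= noi.
have ib : iota i <= b by exact: le_trans ia ab.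
have [k kb kmax] := @Order.TotalTheory.arg_maxP _ _ _ i
  (fun i => iota i <= b) id ib.
have /negP[] := negbT (noi k); rewrite kb /=.
by apply/forallP => j; apply/implyP; exact: kmax.
Qed.

Definition bar (R : realType) (F : fieldType) (m : nat)
    (M' : pmod 'I_m.+1 F) (iota : 'I_m.+2 -> R) : pmod R F :=
  ext0 (hat M') (@bar_index_mono R m.+2 iota) (@bar_index_conv R m.+2 iota).

(** A persistence module is tame when this type is inhabited. *)
Record tame_presentation (R : realType) (F : fieldType) (M : pmod R F) :=
  TamePresentation {
    tp_m : nat;
    tp_mod : pmod 'I_tp_m.+1 F;
    tp_iota : 'I_tp_m.+2 -> R;
    tp_iota_inj : injective tp_iota;
    tp_iota_mono : {homo tp_iota : i j / (i <= j)%O >-> (i <= j)%O};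
    tp_iso : pm_iso M (bar tp_mod tp_iota)
  }.

Definition is_max_rank (R : realType) (F : fieldType) (M N : pmod R F)
    (K : nat) : Prop :=
  (exists (a b : R) (ab : (a <= b)%O),
    pm_rank M ab = K \/ pm_rank N ab = K) /\
  (forall (a b : R) (ab : (a <= b)%O),
    (pm_rank M ab <= K)%N /\ (pm_rank N ab <= K)%N).

(** * The poset of half-open intervals of a finite chain, and its
    Moebius function *)

Record itvs (n : nat) := Itv {
  itv_ends : 'I_n * 'I_n;
  itv_ends_lt : (itv_ends.1 < itv_ends.2)%O
}.

HB.instance Definition _ (n : nat) := [isSub for @itv_ends n].
HB.instance Definition _ (n : nat) := [Finite of itvs n by <:].

Definition itv_lo (n : nat) (I : itvs n) : 'I_n := (itv_ends I).1.
Definition itv_hi (n : nat) (I : itvs n) : 'I_n := (itv_ends I).2.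

Definition itv_set (n : nat) (I : itvs n) : {set 'I_n} :=
  [set x | (itv_lo I <= x < itv_hi I)%O]%SET.

Definition itvs_le (n : nat) : rel (itvs n) :=
  fun I J => itv_set I \subset itv_set J.

Lemma itvs_leE (n : nat) (I J : itvs n) :
  itvs_le I J = (itv_lo J <= itv_lo I)%O && (itv_hi I <= itv_hi J)%O.
Proof.
case: I J => [[a b] ab] [[c e] ce]; rewrite /itvs_le /itv_set /itv_lo /itv_hi /=.
rewrite /= in ab ce; apply/fintype.subsetP/andP => [sub|[ca be] x].
  have ca : (c <= a)%O by have := sub a; rewrite !inE lexx ab => /(_ isT)/andP[].
  split=> //; rewrite leNgt; apply/negP => eb.
  have : (c <= e)%O by exact: ltW.
  have [ae|ea] := leP a e.
    by move=> _; have := sub e; rewrite !inE ae eb ltxx andbF => /(_ isT).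
  by move=> _; have := sub a; rewrite !inE lexx ab (ltNge a) (ltW ea) andbF => /(_ isT).
rewrite !inE => /andP[ax xb].
by rewrite (le_trans ca ax) (lt_le_trans xb be).
Qed.

Fact itvs_le_refl (n : nat) : reflexive (@itvs_le n).
Proof. by move=> I; exact: subxx. Qed.

Fact itvs_le_anti (n : nat) : antisymmetric (@itvs_le n).
Proof.
move=> I J; rewrite !itvs_leE => /andP[/andP[h1 h2] /andP[h3 h4]].
apply: val_inj; rewrite /= [itv_ends I]surjective_pairing.
rewrite [itv_ends J]surjective_pairing; congr pair; apply/le_anti/andP; split.
- exact: h3.
- exact: h1.
- exact: h2.
- exact: h4.
Qed.

Fact itvs_le_trans (n : nat) : transitive (@itvs_le n).
Proof. by move=> J I L; exact: fintype.subset_trans. Qed.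

Fact itvs_display : Order.disp_t.
Proof. exact: Order.Disp tt tt. Qed.

HB.instance Definition _ (n : nat) :=
  Order.Le_isPOrder.Build itvs_display (itvs n)
    (@itvs_le_refl n) (@itvs_le_anti n) (@itvs_le_trans n).

(** [k] bounds the depth of the recursion; see [mobius_xx] and [mobius_lt]. *)
Fixpoint mobius_rec (d : Order.disp_t) (T : finPOrderType d) (k : nat)
    (x y : T) : int :=
  if x == y then 1
  else if k is k'.+1 then
    - \sum_(z : T | (x <= z)%O && (z < y)%O) mobius_rec k' x z
  else 0.

Definition mobius (d : Order.disp_t) (T : finPOrderType d) (x y : T) : int :=
  mobius_rec #|T| x y.

Lemma mobius_xx (d : Order.disp_t) (T : finPOrderType d) (x : T) :
  mobius x x = 1.
Proof. by rewrite /mobius; case: #|T| => [|k] /=; rewrite eqxx. Qed.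

Lemma mobius_rec_stable (d : Order.disp_t) (T : finPOrderType d) (k l : nat)
    (x y : T) :
  (#|[pred z : T | (x <= z < y)%O]| <= k)%N ->
  (#|[pred z : T | (x <= z < y)%O]| <= l)%N ->
  mobius_rec k x y = mobius_rec l x y.
Proof.
have empty j u : (#|[pred z : T | (x <= z < u)%O]| <= 0)%N ->
    x != u -> mobius_rec j x u = 0.
  rewrite leqn0 => /eqP/card0_eq e /negbTE xu; case: j => [|j] /=; rewrite xu //.
  by rewrite big_pred0 ?oppr0 // => z; have := e z; rewrite inE.
elim: k l y => [|k IHk] [|l] y hk hl //.
- have [->|xy] := eqVneq x y; first by rewrite /= eqxx.
  by rewrite !empty.
- have [->|xy] := eqVneq x y; first by rewrite /= eqxx.
  by rewrite !empty.
- rewrite /=; case: eqP => // _; congr (- _); apply: eq_bigr => z /andP[xz zy].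
  have lt : (#|[pred u : T | (x <= u < z)%O]| <
             #|[pred u : T | (x <= u < y)%O]|)%N.
    apply: proper_card; apply/fintype.properP; split.
      apply/fintype.subsetP => u; rewrite !inE => /andP[-> uz].
      exact: lt_trans uz zy.
    by exists z; rewrite !inE ?xz ?zy // ltxx andbF.
  by apply: IHk; rewrite -ltnS; [exact: leq_trans lt hk|exact: leq_trans lt hl].
Qed.

Lemma mobius_lt (d : Order.disp_t) (T : finPOrderType d) (x y : T) :
  (x < y)%O ->
  mobius x y = - \sum_(z : T | (x <= z)%O && (z < y)%O) mobius x z.
Proof.
move=> xy; rewrite {1}/mobius.
rewrite (@mobius_rec_stable _ _ _ #|T|.+1); first last.
- exact: leqW (max_card _).
- exact: max_card.
by rewrite /= lt_eqF.
Qed.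

Definition mobius_conv (d : Order.disp_t) (T : finPOrderType d)
    (h : T -> int) (x : T) : int :=
  \sum_(y : T | (x <= y)%O) mobius x y * h y.

(** * Persistence diagrams *)

Lemma itv_inord_le (m : nat) (I : itvs m.+2) :
  ((inord (itv_lo I) : 'I_m.+1) <= (inord (itv_hi I).-1 : 'I_m.+1))%O.
Proof.
case: I => [[[a am] [b bm]] /=]; rewrite ltEord leEord /itv_lo /itv_hi /= => ab.
have b0 : (0 < b)%N by exact: leq_ltn_trans ab.
have ab1 : (a <= b.-1)%N by rewrite -ltnS prednK.
have bm1 : (b.-1 < m.+1)%N by rewrite prednK.
by rewrite !inordK // (leq_ltn_trans ab1 bm1).
Qed.

Definition Rank (F : fieldType) (m : nat) (M' : pmod 'I_m.+1 F)
    (I : itvs m.+2) : nat :=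
  pm_rank M' (itv_inord_le I).

Definition PD (F : fieldType) (m : nat) (M' : pmod 'I_m.+1 F) :
    itvs m.+2 -> int :=
  mobius_conv (fun I => (Rank M' I)%:Z).

Definition PDk (F : fieldType) (m : nat) (M' : pmod 'I_m.+1 F) (k : nat) :
    itvs m.+2 -> int :=
  mobius_conv (fun I => if (k <= Rank M' I)%N then 1 else 0).

(** [h] moved to the plane: [h [x,y)] at [(iota x, iota y)], zero elsewhere. *)
Definition push_diagram (R : realType) (n : nat) (iota : 'I_n -> R)
    (h : itvs n -> int) (z : R * R) : int :=
  if [pick I : itvs n | (iota (itv_lo I), iota (itv_hi I)) == z] is Some J
  then h J else 0.

Definition persistence_diagram (R : realType) (F : fieldType) (M : pmod R F)
    (p : tame_presentation M) : R * R -> int :=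
  push_diagram (@tp_iota R F M p) (PD (tp_mod p)).

Definition graded_persistence_diagram (R : realType) (F : fieldType)
    (M : pmod R F) (p : tame_presentation M) (k : nat) : R * R -> int :=
  push_diagram (@tp_iota R F M p) (PDk (tp_mod p) k).

(** * Wasserstein distance *)

Definition half_plane (R : realType) : set (R * R) := [set z | z.1 < z.2].

Definition diagonal (R : realType) : set (R * R) := [set z | z.1 = z.2].

Definition closed_half_plane (R : realType) : set (R * R) :=
  @half_plane R `|` @diagonal R.

(** The norm of the library on [R * R] is the sup norm. *)
Definition l1_dist (R : realType) (z w : R * R) : R :=
  `|w.1 - z.1| + `|w.2 - z.2|.

(** [D] and [E] are relevant on [half_plane] only, [g] on pairs of points of
    [closed_half_plane] only. The marginals are sums in [\bar R] of families
    whose support is not assumed finite; in particular a coupling exists only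
    when [D] and [E] are nonnegative. *)
Definition coupling (R : realType) (D E : R * R -> int)
    (g : R * R -> R * R -> nat) : Prop :=
  [/\ forall z w, diagonal z -> diagonal w -> g z w = 0%N,
      forall z, half_plane z ->
        ((D z)%:~R)%:E = \esum_(w in @closed_half_plane R) ((g z w)%:R : R)%:E &
      forall w, half_plane w ->
        ((E w)%:~R)%:E = \esum_(z in @closed_half_plane R) ((g z w)%:R : R)%:E].

Definition coupling_cost (R : realType) (g : R * R -> R * R -> nat) : \bar R :=
  \esum_(p in @closed_half_plane R `*` @closed_half_plane R)
    ((g p.1 p.2)%:R * l1_dist p.1 p.2)%:E.

Definition W11 (R : realType) (D E : R * R -> int) : \bar R :=
  ereal_inf [set coupling_cost g | g in coupling D E].

Definition pos_part (T : Type) (A : T -> int) (z : T) : int := Num.max (A z) 0.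
Definition neg_part (T : Type) (A : T -> int) (z : T) : int := Num.max (- A z) 0.

Definition W11_signed (R : realType) (A B : R * R -> int) : \bar R :=
  W11 (fun z => pos_part A z + neg_part B z)
      (fun z => pos_part B z + neg_part A z).

(* Main.v *)
Require Import Defs.
From HB Require Import structures.
From mathcomp Require Import all_boot all_order all_algebra.
From mathcomp Require Import all_classical all_reals all_analysis.
From mathcomp Require Import zify ring lra.
Import Order.TTheory GRing.Theory Num.Theory.
Local Open Scope ring_scope.

Set Implicit Arguments.
Unset Strict Implicit.
Unset Printing Implicit Defensive.

(** The proof rests on two reformulations that remove couplings and Moebius
    functions from the problem.

    Transport. The distance [W11 A B] depends on [A - B] only: it is the infimum
    of the costs of finite lists of moves between points of the closed half plane
    whose boundary (sources minus targets, counted off the diagonal) is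
    [A - B]. Indeed two moves z -> c and c -> w through a common point c can be
    merged into z -> w without increasing the cost, and repeating this turns any
    list with the right boundary into one with the right marginals
    ([W11_kr_norm]). The resulting [kr_norm] is subadditive. As [D] and [E] are
    the sums of the [Dk] and [Ek] over 1 <= k <= K, this gives the lower bound
    ([W11_le_sum_graded]).

    Barcodes. A tame module has a nonnegative diagram, hence a finite multiset
    [B] of bars, and the rank at [[a, b)] counts the bars that contain
    [[a, b)]. Both diagrams are alternating sums of four counts of bars around
    a point, so they depend on [B] only ([tame_barcode]). Nonnegativity is
    Frobenius' rank inequality.

    Upper bound. It suffices that moving the bars along a list of moves of cost
    c changes the graded diagrams, summed over k, by at most (2K - 1) c
    ([graded_stability]). Because distances are l1, each move z -> w may be
    replaced at no cost by shrinking z to the intersection of z and w (or to the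
    diagonal) and growing the result to w. Performing all shrinkings before all
    growings keeps the ranks at most K. When the left end of one bar moves from
    x to x', with no other left end strictly in between, the region where the
    rank is at least k changes by the rectangle [[x, x')] times (t_k, t_(k-1)],
    cut off at the diagonal, for a decreasing sequence of thresholds t_0 >= ... >= t_K = x. So the k-th
    diagram changes by four points, which two moves of length at most x' - x
    account for, and the second of them is trivial for k = K: 2K - 1 moves in
    total ([reach_strip]).

    Sharpness. K copies of the bar [[0, 1)] against no bar give equality on the
    left. On the right, take K bars starting at 0, of lengths 2, ..., K + 1, and
    move the left end of the longest one to 1. Then all the thresholds are far
    apart, and tent functions, which are 1-Lipschitz, show that the 2K - 1 moves
    above cannot be improved. *)

(** * Moves and the Kantorovich-Rubinstein norm *)

Section Transport.
Context {R : realType}.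
Implicit Types (z w c : R * R) (s t : seq ((R * R) * (R * R))) (f g : R * R -> int).

Definition valid_moves s : bool :=
  all (fun m => (m.1.1 <= m.1.2) && (m.2.1 <= m.2.2)) s.

Definition moves_cost s : R := \sum_(m <- s) l1_dist m.1 m.2.

Definition moves_boundary s z : int :=
  (count_mem z (map fst s))%:Z - (count_mem z (map snd s))%:Z.

Definition transports s f : Prop :=
  valid_moves s /\ forall z, z.1 < z.2 -> f z = moves_boundary s z.

(** The Kantorovich-Rubinstein norm relative to the diagonal: mass may be
    created and absorbed there for free. *)
Definition kr_norm f : \bar R :=
  ereal_inf [set (moves_cost s)%:E | s in [set s | transports s f]]%classic.

Definition represents (A : R * R -> int) (L : seq (R * R)) : Prop :=
  forall z, z.1 < z.2 -> A z = (count_mem z L)%:Z.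

Lemma closed_half_planeE z : @closed_half_plane R z <-> z.1 <= z.2.
Proof.
rewrite /closed_half_plane /half_plane /diagonal /setU /=; split.
  by move=> [/ltW|->].
by rewrite le_eqVlt => /orP[/eqP|]; [right|left].
Qed.

Lemma l1_dist_ge0 z w : 0 <= l1_dist z w.
Proof. by rewrite addr_ge0. Qed.

Lemma l1_distC z w : l1_dist z w = l1_dist w z.
Proof. by rewrite /l1_dist distrC (distrC w.2). Qed.

Lemma l1_dist_triangle c z w : l1_dist z w <= l1_dist z c + l1_dist c w.
Proof.
rewrite /l1_dist addrACA; apply: lerD.
  by rewrite -(subrKA c.1) (le_trans (ler_normD _ _)) // addrC.
by rewrite -(subrKA c.2) (le_trans (ler_normD _ _)) // addrC.
Qed.

Lemma moves_cost_ge0 s : 0 <= moves_cost s.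
Proof. by apply: sumr_ge0 => m _; exact: l1_dist_ge0. Qed.

Lemma moves_cost_cons m s :
  moves_cost (m :: s) = l1_dist m.1 m.2 + moves_cost s.
Proof. by rewrite /moves_cost big_cons. Qed.

Lemma moves_cost_cat s t : moves_cost (s ++ t) = moves_cost s + moves_cost t.
Proof. by rewrite /moves_cost big_cat. Qed.

Lemma moves_boundary_cat s t z :
  moves_boundary (s ++ t) z = moves_boundary s z + moves_boundary t z.
Proof. by rewrite /moves_boundary !map_cat !count_cat; lia. Qed.

Lemma transportsD s t f g :
  transports s f -> transports t g -> transports (s ++ t) (fun z => f z + g z).
Proof.
move=> [vs es] [vt et]; split; first by rewrite /valid_moves all_cat [all _ s]vs.
by move=> z zlt; rewrite es // et // moves_boundary_cat.
Qed.

Definition swap_move (m : (R * R) * (R * R)) := (m.2, m.1).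

Lemma transportsN s f :
  transports s f -> transports (map swap_move s) (fun z => - f z).
Proof.
move=> [vs es]; split.
  by rewrite /valid_moves all_map; apply: sub_all vs => m /=; rewrite andbC.
by move=> z zlt; rewrite es // /moves_boundary -!map_comp /= opprB.
Qed.

Lemma moves_cost_swap s : moves_cost (map swap_move s) = moves_cost s.
Proof. by rewrite /moves_cost big_map; apply: eq_bigr => m _; rewrite l1_distC. Qed.

(** Cancellation: mass passing through a point c, that is a move arriving at c
    and a move leaving c, can be sent directly by the triangle inequality.
    Each such step makes the list shorter, until its sources are exactly [A]. *)
Lemma exact_marginals s (A B : seq (R * R)) :
  valid_moves s ->
  (forall z, z.1 < z.2 -> (count_mem z A <= count_mem z (map fst s))%N) ->
  (forall z, z.1 < z.2 -> (count_mem z A + count_mem z (map snd s) =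
     count_mem z B + count_mem z (map fst s))%N) ->
  exists t, [/\ valid_moves t, moves_cost t <= moves_cost s,
    forall z, z.1 < z.2 -> count_mem z (map fst t) = count_mem z A &
    forall z, z.1 < z.2 -> count_mem z (map snd t) = count_mem z B].
Proof.
have [n] := ubnP (size s); elim: n s => // n IH s; rewrite ltnS => sn vs leA AB.
have [/hasP[c _ /andP[chp cA]]|/hasPn noc] := boolP
  (has (fun c => (c.1 < c.2) && (count_mem c A < count_mem c (map fst s))%N)
    (map fst s)); last first.
  have eqA z : z.1 < z.2 -> count_mem z (map fst s) = count_mem z A.
    move=> zlt; have := leA z zlt.
    have [/noc|/count_memPn ->] := boolP (z \in map fst s).
      by rewrite zlt -leqNgt /= => le1 le2; apply/eqP; rewrite eqn_leq le1.
    by rewrite leqn0 => /eqP ->.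
  exists s; split=> // z zlt; have := AB z zlt.
  by rewrite eqA // addnC => /addIn.
have cfst : c \in map fst s.
  by rewrite -has_pred1 has_count (leq_ltn_trans _ cA).
have csnd : c \in map snd s.
  rewrite -has_pred1 has_count -(ltn_add2l (count_mem c A)) addn0 AB //.
  by rewrite ltn_addl.
have {cfst} [[c' w] /= cws ecc] := mapP cfst; subst c'.
(* [(c, w)] is a move leaving a point with too much mass. *)
have s1P := perm_to_rem cws; set s1 := rem _ s in s1P.
have fsts z : count_mem z (map fst s) = ((c == z) + count_mem z (map fst s1))%N.
  by rewrite (permP (perm_map fst s1P)) /=.
have snds z : count_mem z (map snd s) = ((w == z) + count_mem z (map snd s1))%N.
  by rewrite (permP (perm_map snd s1P)) /=.
have costs : moves_cost s = l1_dist c w + moves_cost s1.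
  by rewrite -[RHS](moves_cost_cons (c, w)) /moves_cost (perm_big _ s1P).
have size1 : size s = (size s1).+1 by rewrite (perm_size s1P).
move: (vs); rewrite /valid_moves (perm_all _ s1P) /= => /andP[/andP[_ wle] vs1].
have [ecw|ncw] := eqVneq c w.
  have [||||t [vt ct tA tB]] := IH s1; first by rewrite size1 in sn.
  - exact: vs1.
  - move=> z zlt; have := leA z zlt; rewrite fsts.
    by case: eqP => [<-|_] //; move: cA; rewrite fsts eqxx.
  - by move=> z zlt; have := AB z zlt; rewrite fsts snds ecw !(addnCA _ (w == z)) => /addnI.
  exists t; split=> //; apply: (le_trans ct).
  by rewrite costs lerDr l1_dist_ge0.
(* [(x, c)] is a move arriving there; replace both by [(x, w)]. *)
have c1 : c \in map snd s1.
  move: csnd; rewrite -!has_pred1 !has_count snds.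
  by rewrite eq_sym (negbTE ncw).
have [[x c'] /= xcs1 ecc] := mapP c1; subst c'.
have s2P := perm_to_rem xcs1; set s2 := rem _ s1 in s2P.
have fsts1 z : count_mem z (map fst s1) = ((x == z) + count_mem z (map fst s2))%N.
  by rewrite (permP (perm_map fst s2P)) /=.
have snds1 z : count_mem z (map snd s1) = ((c == z) + count_mem z (map snd s2))%N.
  by rewrite (permP (perm_map snd s2P)) /=.
have costs1 : moves_cost s1 = l1_dist x c + moves_cost s2.
  by rewrite -[RHS](moves_cost_cons (x, c)) /moves_cost (perm_big _ s2P).
have size2 : size s1 = (size s2).+1 by rewrite (perm_size s2P).
move: (vs1); rewrite (perm_all _ s2P) /= => /andP[/andP[xle _] vs2].
have [||||t [vt ct tA tB]] := IH ((x, w) :: s2).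
- by rewrite /= -size2 -size1.
- by rewrite /valid_moves /= xle wle.
- move=> z zlt; have := leA z zlt; rewrite /= fsts fsts1.
  by case: eqP => [<-|_] //; move: cA; rewrite fsts fsts1 eqxx.
- move=> z zlt; have := AB z zlt.
  by rewrite /= fsts snds fsts1 snds1 !(addnCA _ (c == z)) => /addnI.
exists t; split=> //; apply: (le_trans ct).
rewrite moves_cost_cons costs costs1 addrA lerD2r.
by rewrite (le_trans (l1_dist_triangle c _ _)) // addrC.
Qed.

(** Adding the moves z -> z for z in [A] costs nothing and provides enough
    sources for the cancellation to apply. *)
Lemma transports_exact s (A B : R * R -> int) LA LB :
  represents A LA -> represents B LB ->
  transports s (fun z => A z - B z) ->
  exists t, [/\ valid_moves t, moves_cost t <= moves_cost s,
    represents A (map fst t) & represents B (map snd t)].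
Proof.
move=> rA rB [vs es].
(* Points of [LA] below the diagonal are not legal end points of moves. *)
set LA' := [seq z <- LA | z.1 <= z.2].
set s' := s ++ [seq (z, z) | z <- LA'].
have fsts z : count_mem z (map fst s') =
    (count_mem z (map fst s) + count_mem z LA')%N.
  by rewrite /s' map_cat count_cat -map_comp map_id.
have snds z : count_mem z (map snd s') =
    (count_mem z (map snd s) + count_mem z LA')%N.
  by rewrite /s' map_cat count_cat -map_comp map_id.
have LA'E z : z.1 < z.2 -> count_mem z LA' = count_mem z LA.
  move=> zlt; rewrite count_filter; apply: eq_count => w /=.
  by case: eqP => // ->; rewrite ltW.
have [|||t [vt ct tA tB]] := @exact_marginals s' LA LB.
- rewrite /valid_moves all_cat [all _ s]vs /= all_map; apply/allP => z /=.
  by rewrite mem_filter => /andP[-> _].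
- by move=> z zlt; rewrite fsts LA'E // leq_addl.
- move=> z zlt; rewrite fsts snds; have := es z zlt.
  by rewrite rA // rB // /moves_boundary; clear; lia.
exists t; split=> //.
- rewrite (le_trans ct) // moves_cost_cat [X in _ + X](_ : _ = 0) ?addr0 //.
  rewrite /moves_cost big_map big1 // => z _.
  by rewrite /l1_dist !subrr normr0 addr0.
- by move=> z zlt; rewrite rA // tA.
- by move=> z zlt; rewrite rB // tB.
Qed.

Lemma esum_count_weight (T : choiceType) (S : set T) (u : seq T) (h : T -> R) :
  (forall x, 0 <= h x) -> {in u, forall x, S x} ->
  \esum_(x in S) ((count_mem x u)%:R * h x)%:E = (\sum_(x <- u) h x)%:E.
Proof.
move=> h0 uS.
under eq_esum => x _.
  rewrite -sum1_count big_mkcond natr_sum mulr_suml -sumEFin; over.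
rewrite esum_sum; last first.
  by move=> x y _ _; rewrite lee_fin mulr_ge0 ?h0 ?ler0n.
rewrite -sumEFin big_seq_cond [RHS]big_seq_cond.
apply: eq_bigr => y /andP[/uS Sy _].
rewrite (esumID [set y]%classic); last first.
  by move=> x _; rewrite lee_fin mulr_ge0 ?h0 ?ler0n.
rewrite (_ : S `&` _ = [set y])%classic; last first.
  by apply/seteqP; split=> [x []//|x ->]; split.
rewrite esum_set1 ?lee_fin ?mulr_ge0 ?h0 //= eqxx mul1r.
rewrite esum1 ?adde0 // => x [_ /= /eqP xy].
by rewrite eq_sym (negbTE xy) mul0r.
Qed.

Lemma esum_count_fst s z : valid_moves s ->
  \esum_(w in @closed_half_plane R) ((count_mem (z, w) s)%:R : R)%:E =
    ((count_mem z (map fst s))%:R : R)%:E.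
Proof.
move=> vs; set u := [seq m.2 | m <- s & m.1 == z].
have cu w : count_mem (z, w) s = count_mem w u.
  rewrite /u count_map count_filter; apply: eq_count => -[a b] /=.
  by rewrite xpair_eqE andbC.
transitivity (\esum_(w in @closed_half_plane R)
    ((count_mem w u)%:R * 1%R : R)%:E).
  by apply: eq_esum => w _; rewrite cu mulr1.
rewrite esum_count_weight //; last first.
  move=> w /mapP[m]; rewrite mem_filter => /andP[_ ms] ->.
  by apply/closed_half_planeE; have := allP vs _ ms => /andP[].
by rewrite big_const_seq count_predT iter_addr_0 size_map size_filter count_map.
Qed.

Lemma esum_count_snd s w : valid_moves s ->
  \esum_(z in @closed_half_plane R) ((count_mem (z, w) s)%:R : R)%:E =
    ((count_mem w (map snd s))%:R : R)%:E.
Proof.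
move=> vs; set t := map swap_move s.
have vt : valid_moves t.
  by rewrite /valid_moves all_map; apply: sub_all vs => m /=; rewrite andbC.
rewrite (_ : map snd s = map fst t); last by rewrite -map_comp.
rewrite -esum_count_fst //; apply: eq_esum => z _.
rewrite /t count_map; congr (_%:R%:E); apply: eq_count => -[a b] /=.
by rewrite !xpair_eqE andbC.
Qed.

Lemma esum_count_cost s : valid_moves s ->
  \esum_(p in @closed_half_plane R `*` @closed_half_plane R)
    ((count_mem p s)%:R * l1_dist p.1 p.2)%:E = (moves_cost s)%:E.
Proof.
move=> vs; rewrite esum_count_weight //.
  by move=> p; exact: l1_dist_ge0.
by move=> p ps; have := allP vs _ ps => /andP[? ?]; split; apply/closed_half_planeE.
Qed.

Lemma multiset_of_function (T : eqType) (L : seq T) (h : T -> nat) :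
  uniq L -> exists u, forall x, count_mem x u = if x \in L then h x else 0%N.
Proof.
elim: L => [_|y L IH /= /andP[yL /IH[u hu]]]; first by exists [::].
exists (nseq (h y) y ++ u) => x; rewrite count_cat count_nseq hu /= inE eq_sym.
by case: eqP => [->|_] /=; rewrite ?(negbTE yL) ?mul1n ?addn0.
Qed.

(** A coupling is not assumed to be finitely supported. Each of its marginals is
    finite, and removing from a sum of natural numbers one nonzero term
    decreases its value, so its support is finite. *)
Lemma finite_support_of_esum (T : choiceType) (S : set T) (h : T -> nat) (n : nat) :
  ((n%:R : R)%:E = \esum_(x in S) ((h x)%:R : R)%:E) ->
  exists2 L : seq T, (size L <= n)%N & forall x, S x -> h x != 0%N -> x \in L.
Proof.
have h0 (U : set T) x : U x -> (0 <= ((h x)%:R : R)%:E)%E.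
  by rewrite lee_fin ler0n.
have [k] := ubnP n; elim: k n S => // k IH n S nk nE.
have [[x [Sx hx]]|no] := pselect (exists x, S x /\ h x != 0%N); last first.
  by exists [::] => // x Sx hx; case: no; exists x.
move: nE; rewrite (esumID [set x]%classic); last exact: h0.
rewrite (_ : S `&` _ = [set x])%classic; last first.
  by apply/seteqP; split=> [y []//|y ->]; split.
rewrite esum_set1; last by rewrite lee_fin ler0n.
have := esum_ge0 (@h0 (S `&` ~` [set x])%classic).
case eE : (\esum_(_ in _) _)%E => [r| |] //; rewrite lee_fin => r0 [nE].
have hn : (h x <= n)%N by rewrite -(ler_nat R) nE lerDl.
have [||L Ln LP] := IH (n - h x)%N (S `&` ~` [set x])%classic.
- by lia.
- by rewrite eE; congr EFin; rewrite natrB // nE addrC addrK.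
exists (x :: L) => [|y Sy hy]; first by rewrite /=; lia.
rewrite inE; case: eqVneq => //= yx.
by apply: LP => //; split=> //=; apply/eqP.
Qed.

Lemma coupling_moves (A B : R * R -> int) LA LB (g : R * R -> R * R -> nat) :
  represents A LA -> represents B LB -> coupling A B g ->
  exists s, [/\ valid_moves s, (moves_cost s)%:E = coupling_cost g,
    represents A (map fst s) & represents B (map snd s)].
Proof.
move=> rA rB [gD gA gB].
have natE (m : nat) : ((m%:Z)%:~R : R) = m%:R by rewrite pmulrn.
have /choice[LF LFP] : forall z, exists L : seq (R * R), z.1 < z.2 ->
    forall w, w.1 <= w.2 -> g z w != 0%N -> w \in L.
  move=> z; have [zlt|_] := boolP (z.1 < z.2); last by exists [::].
  have := gA z zlt; rewrite rA // natE => /finite_support_of_esum[L _ LP].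
  by exists L => _ w /closed_half_planeE; exact: LP.
have /choice[LG LGP] : forall w, exists L : seq (R * R), w.1 < w.2 ->
    forall z, z.1 <= z.2 -> g z w != 0%N -> z \in L.
  move=> w; have [wlt|_] := boolP (w.1 < w.2); last by exists [::].
  have := gB w wlt; rewrite rB // natE => /finite_support_of_esum[L _ LP].
  by exists L => _ z /closed_half_planeE; exact: LP.
pose ok (p : (R * R) * (R * R)) := (p.1.1 <= p.1.2) && (p.2.1 <= p.2.2).
(* Every pair charged by [g] has an end point off the diagonal, so it lies in
   one of finitely many rows or columns, each of them finite. *)
pose L := undup (seq.filter ok ([seq (z, w) | z <- LA, w <- LF z] ++
                            [seq (z, w) | w <- LB, z <- LG w])).
have memL z w : z.1 <= z.2 -> w.1 <= w.2 -> g z w != 0%N -> (z, w) \in L.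
  move=> zle wle gzw; rewrite mem_undup mem_filter /ok /= zle wle /= mem_cat.
  have [zlt|zd] := boolP (z.1 < z.2).
    apply/orP; left; apply/allpairsPdep; exists z, w; split=> //; last exact: LFP.
    rewrite -has_pred1 has_count lt0n; apply/eqP => z0.
    have := gA z zlt; rewrite rA // z0 natE => /finite_support_of_esum[[]//= _ /(_ w)].
    by rewrite closed_half_planeE gzw => /(_ wle isT).
  have [wlt|wd] := boolP (w.1 < w.2).
    apply/orP; right; apply/allpairsPdep; exists w, z; split=> //; last exact: LGP.
    rewrite -has_pred1 has_count lt0n; apply/eqP => z0.
    have := gB w wlt; rewrite rB // z0 natE => /finite_support_of_esum[[]//= _ /(_ z)].
    by rewrite closed_half_planeE gzw => /(_ zle isT).
  move: gzw; rewrite gD //; apply/eqP; rewrite eq_le.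
    by rewrite zle leNgt zd.
  by rewrite wle leNgt wd.
have [s sP] := multiset_of_function (fun p => g p.1 p.2) (undup_uniq _ : uniq L).
have vs : valid_moves s.
  apply/allP => p; rewrite -has_pred1 has_count sP.
  by case: ifP => //; rewrite mem_undup mem_filter => /andP[].
have sg z w : @closed_half_plane R z -> @closed_half_plane R w ->
    g z w = count_mem (z, w) s.
  move=> /closed_half_planeE zle /closed_half_planeE wle; rewrite sP /=.
  by case: ifPn => // zwL; apply/eqP/(contraNT _ zwL); exact: memL.
exists s; split=> //.
- rewrite -esum_count_cost // /coupling_cost; apply: eq_esum => p [p1 p2].
  by rewrite (sg p.1 p.2) // -surjective_pairing.
- move=> z zlt; apply/eqP; rewrite -(eqr_int R); apply/eqP/EFin_inj.
  rewrite gA // natE -esum_count_fst //; apply: eq_esum => w wle.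
  by rewrite sg //; apply/closed_half_planeE/ltW.
- move=> w wlt; apply/eqP; rewrite -(eqr_int R); apply/eqP/EFin_inj.
  rewrite gB // natE -esum_count_snd //; apply: eq_esum => z zle.
  by rewrite sg //; apply/closed_half_planeE/ltW.
Qed.

(** Moves inside the diagonal are discarded, as couplings vanish there. *)
Lemma moves_coupling (A B : R * R -> int) s :
  valid_moves s -> represents A (map fst s) -> represents B (map snd s) ->
  exists2 g, coupling A B g & (coupling_cost g <= (moves_cost s)%:E)%E.
Proof.
move=> vs rA rB.
pose off (m : (R * R) * (R * R)) := (m.1.1 < m.1.2) || (m.2.1 < m.2.2).
pose t := seq.filter off s.
have vt : valid_moves t.
  by apply/allP => m; rewrite mem_filter => /andP[_ /(allP vs)].
have natE (m : nat) : ((m%:Z)%:~R : R) = m%:R by rewrite pmulrn.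
exists (fun z w => count_mem (z, w) t); first split.
- move=> z w zd wd; apply/count_memPn; rewrite mem_filter /off /=.
  by rewrite zd wd !ltxx.
- move=> z zlt; rewrite esum_count_fst // rA // natE; congr (_%:R%:E).
  rewrite !count_map count_filter; apply: eq_count => -[a b] /=.
  by rewrite /off /=; case: eqP => // ->; rewrite zlt.
- move=> w wlt; rewrite esum_count_snd // rB // natE; congr (_%:R%:E).
  rewrite !count_map count_filter; apply: eq_count => -[a b] /=.
  by rewrite /off /=; case: eqP => // ->; rewrite wlt orbT.
rewrite [leLHS](_ : _ = (moves_cost t)%:E); last first.
  by rewrite -esum_count_cost //; apply: eq_esum => -[].
rewrite lee_fin /moves_cost big_filter [leRHS](bigID off) /= lerDl.
by apply: sumr_ge0 => m _; exact: l1_dist_ge0.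
Qed.

(** For nonnegative diagrams the distance depends on their difference alone,
    which makes it subadditive and applies equally to signed diagrams. *)
Lemma W11_kr_norm (A B : R * R -> int) LA LB :
  represents A LA -> represents B LB ->
  W11 A B = kr_norm (fun z => A z - B z).
Proof.
move=> rA rB; apply/eqP; rewrite eq_le; apply/andP; split.
  apply: le_ereal_inf_tmp => _ [s trs <-].
  have [t [vt ct tA tB]] := transports_exact rA rB trs.
  have [g gAB cg] := moves_coupling vt tA tB.
  apply: (@le_trans _ _ (coupling_cost g)); first by apply: ereal_inf_lbound; exists g.
  by rewrite (le_trans cg) // lee_fin.
apply: le_ereal_inf_tmp => _ [g gAB <-].
have [s [vs <- sA sB]] := coupling_moves rA rB gAB.
apply: ereal_inf_lbound; exists s => //; split=> // z zlt.
by rewrite sA // sB.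
Qed.

Lemma kr_norm_ge0 f : (0 <= kr_norm f)%E.
Proof.
apply: le_ereal_inf_tmp => _ [s _ <-].
by rewrite lee_fin moves_cost_ge0.
Qed.

Lemma kr_norm_le f s : transports s f -> (kr_norm f <= (moves_cost s)%:E)%E.
Proof. by move=> trs; apply: ereal_inf_lbound; exists s. Qed.

Lemma eq_kr_norm f g : (forall z, z.1 < z.2 -> f z = g z) ->
  kr_norm f = kr_norm g.
Proof.
move=> fg; congr ereal_inf; apply/seteqP.
split=> _ [s [vs es] <-]; exists s => //; split=> // z zlt.
  by rewrite -fg // es.
by rewrite fg // es.
Qed.

Lemma kr_normD f g : (kr_norm (fun z => (f z + g z)%R) <= kr_norm f + kr_norm g)%E.
Proof.
have [|fy] := eqVneq (kr_norm f) +oo%E.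
  by move=> ->; rewrite addye ?leey // gt_eqF // (lt_le_trans _ (kr_norm_ge0 _)).
have [|gy] := eqVneq (kr_norm g) +oo%E.
  by move=> ->; rewrite addey ?leey // gt_eqF // (lt_le_trans _ (kr_norm_ge0 _)).
have ff : kr_norm f \is a fin_num.
  by rewrite ge0_fin_numE ?kr_norm_ge0 // ltey.
have gf : kr_norm g \is a fin_num.
  by rewrite ge0_fin_numE ?kr_norm_ge0 // ltey.
apply/lee_addgt0Pr => e e0.
have e2 : 0 < e / 2 by rewrite divr_gt0.
have [_ [s trs <-] sf] := lb_ereal_inf_adherent e2 ff.
have [_ [t trt <-] tg] := lb_ereal_inf_adherent e2 gf.
rewrite (le_trans (kr_norm_le (transportsD trs trt))) //.
rewrite moves_cost_cat EFinD (splitr e) EFinD addeACA.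
by apply: leeD; exact: ltW.
Qed.

Lemma kr_norm0 f : (forall z, z.1 < z.2 -> f z = 0) -> kr_norm f = 0%E.
Proof.
move=> f0; apply/eqP; rewrite eq_le kr_norm_ge0 andbT.
have : transports [::] f by split=> // z /f0 ->; rewrite /moves_boundary.
by move/kr_norm_le; rewrite /moves_cost big_nil.
Qed.

Lemma kr_norm_sum (I : Type) (r : seq I) (f : I -> R * R -> int) :
  (kr_norm (fun z => (\sum_(i <- r) f i z)%R) <= \sum_(i <- r) kr_norm (f i))%E.
Proof.
elim: r => [|i r IH].
  by rewrite big_nil kr_norm0 // => z _; rewrite big_nil.
rewrite big_cons; apply: le_trans (leeD (lexx _) IH).
rewrite (@eq_kr_norm _ (fun z => f i z + \sum_(i <- r) f i z)) ?kr_normD //.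
by move=> z _; rewrite big_cons.
Qed.

End Transport.
(** * Graded diagrams of barcodes and their variation *)

Section Barcodes.
Context {R : realType}.
Implicit Types (B C : seq (R * R)) (z w p : R * R) (x y a b : R).

(** The number of bars containing the interval [z], where the flags [c] and [d]
    tell whether an end point of a bar may coincide with that of [z]. A strict
    inequality amounts to evaluating the rank just before [z.1], or just
    after [z.2]. *)
Definition bar_count (c d : bool) B z : nat :=
  count (fun p => (p.1 < z.1 ?<= if c) && (z.2 < p.2 ?<= if d)) B.

(** The Moebius inversion of the indicator function of the intervals of rank at
    least [k], expressed without reference to a grid containing the end points. *)
Definition graded_diagram (k : nat) B z : int :=
  (k <= bar_count true true B z)%N%:Z - (k <= bar_count false true B z)%N%:Z
  - (k <= bar_count true false B z)%N%:Z + (k <= bar_count false false B z)%N%:Z.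

(** The graded diagrams of [B] can be carried to those of [B'], for
    1 <= k <= K, at total cost [r]; the lists of moves are shifted by one. *)
Definition graded_reach (K : nat) B B' (r : R) : Prop :=
  exists s : nat -> seq ((R * R) * (R * R)),
    (forall k, transports (s k) (fun z => graded_diagram k.+1 B z - graded_diagram k.+1 B' z)) /\
    \sum_(k < K) moves_cost (s k) <= r.

Definition same_counts B B' : Prop :=
  forall c d z, z.1 < z.2 -> bar_count c d B z = bar_count c d B' z.

Definition rank_le (K : nat) B : Prop :=
  forall z, z.1 < z.2 -> (bar_count true true B z <= K)%N.

Lemma bar_count_perm B B' : perm_eq B B' -> same_counts B B'.
Proof. by move=> BB' c d z _; exact/permP. Qed.

Lemma bar_countE c d B z : z.1 < z.2 ->
  bar_count c d B z = bar_count c d (seq.filter (fun p => p.1 < p.2) B) z.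
Proof.
move=> zlt; rewrite /bar_count count_filter; apply: eq_count => p /=.
case: andP => //= -[h1 h2]; symmetry; apply: le_lt_trans (lteifW h1) _.
exact: lt_le_trans zlt (lteifW h2).
Qed.

Lemma represents_same_counts (A : R * R -> int) B B' :
  represents A B -> represents A B' -> same_counts B B'.
Proof.
move=> rB rB' c d z zlt; rewrite bar_countE // [RHS]bar_countE //.
apply/permP; apply/allP => p _ /=; rewrite !count_filter.
rewrite (eq_count (a2 := fun q => (p.1 < p.2) && (q == p))); last first.
  by move=> q /=; case: eqP => [->|_]; rewrite ?andbT ?andbF.
rewrite [X in _ == X](eq_count (a2 := fun q => (p.1 < p.2) && (q == p))); last first.
  by move=> q /=; case: eqP => [->|_]; rewrite ?andbT ?andbF.
have [plt|_] /= := boolP (p.1 < p.2); last by rewrite !count_pred0.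
by apply/eqP; case: (etrans (esym (rB p plt)) (rB' p plt)).
Qed.

Lemma same_counts_graded B B' k z : same_counts B B' -> z.1 < z.2 ->
  graded_diagram k B z = graded_diagram k B' z.
Proof. by move=> BB' zlt; rewrite /graded_diagram !BB'. Qed.

Lemma same_counts_rank_le K B B' : same_counts B B' -> rank_le K B -> rank_le K B'.
Proof. by move=> BB' rB z zlt; rewrite -BB' // rB. Qed.

Lemma eq_transports s (f g : R * R -> int) :
  (forall z, z.1 < z.2 -> f z = g z) -> transports s f -> transports s g.
Proof. by move=> fg [vs es]; split=> // z zlt; rewrite -fg // es. Qed.

Lemma same_counts_reach K B B' r :
  0 <= r -> same_counts B B' -> graded_reach K B B' r.
Proof.
move=> r0 BB'; exists (fun=> [::]); split; last first.
  by rewrite big1 // => k _; rewrite /moves_cost big_nil.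
move=> k; split=> // z zlt.
by rewrite (same_counts_graded _ BB') // subrr.
Qed.

Lemma reach_trans K B2 B1 B3 r r' :
  graded_reach K B1 B2 r -> graded_reach K B2 B3 r' ->
  graded_reach K B1 B3 (r + r').
Proof.
move=> [s [trs cs]] [t [trt ct]]; exists (fun k => s k ++ t k); split.
  move=> k; apply: eq_transports (transportsD (trs k) (trt k)) => z _.
  by rewrite addrA subrK.
under eq_bigr do rewrite moves_cost_cat; rewrite big_split /=.
exact: lerD.
Qed.

Lemma reach_sym K B B' r : graded_reach K B B' r -> graded_reach K B' B r.
Proof.
move=> [s [trs cs]]; exists (fun k => map swap_move (s k)); split.
  by move=> k; apply: eq_transports (transportsN (trs k)) => z _; rewrite opprB.
by under eq_bigr do rewrite moves_cost_swap.
Qed.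

Lemma reach_le K B B' r r' : r <= r' -> graded_reach K B B' r ->
  graded_reach K B B' r'.
Proof. by move=> rr' [s [trs cs]]; exists s; split=> //; exact: le_trans rr'. Qed.

(** No other bar starts strictly between [x] and [x'], so on that strip the rank
    of [C] at [(a, b)] depends on [b] only, and the intervals at which it is at
    least [j] are those with b <= t j. The bar moved to [x'] loses there the
    rank k + 1 exactly where [C] has rank k, that is for t (k + 1) < b <= t k.
    The mixed difference of the indicator of this rectangle is a product. *)
Lemma strip_graded x x' y C (t : nat -> R) k z :
  z.1 < z.2 -> x <= x' ->
  (forall p, p \in C -> ~~ (x < p.1 < x')) ->
  (forall j d b, x < b ->
    (b < y ?<= if d) && (j <= bar_count true d C (x, b))%N = (b < t j ?<= if d)) ->
  graded_diagram k.+1 ((x, y) :: C) z - graded_diagram k.+1 ((x', y) :: C) z =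
    ((z.1 == x)%:Z - (z.1 == x')%:Z) * ((z.2 == t k)%:Z - (z.2 == t k.+1)%:Z).
Proof.
case: z => a b /= ab xx' noC tP.
(* Each of the four terms of the diagrams differs by a product. *)
have key c d :
    (k < bar_count c d ((x, y) :: C) (a, b))%N%:Z -
    (k < bar_count c d ((x', y) :: C) (a, b))%N%:Z =
    ((x < a ?<= if c)%:Z - (x' < a ?<= if c)%:Z) *
    ((b < t k ?<= if d)%:Z - (b < t k.+1 ?<= if d)%:Z).
  rewrite /bar_count /=.
  have [x'a|nx'a] := boolP (x' < a ?<= if c).
    have -> : (x < a ?<= if c).
      by case: c x'a => /=; [exact: le_trans|exact: le_lt_trans].
    by rewrite !subrr mul0r.
  have [xa|nxa] := boolP (x < a ?<= if c); last by rewrite !subrr mul0r.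
  have xb : x < b by exact: le_lt_trans (lteifW xa) ab.
  rewrite -!tP // -[count _ C]/(bar_count c d C (a, b)).
  have -> : bar_count c d C (a, b) = bar_count true d C (x, b).
    apply: eq_in_count => p /noC pC /=; congr andb.
    case: c nx'a xa => /=; rewrite -?leNgt -?ltNge => nx'a xa.
      apply/idP/idP => [pa|px]; last exact: le_trans px xa.
      by rewrite leNgt; apply: contra pC => ->; exact: le_lt_trans pa nx'a.
    apply/idP/idP => [pa|px]; last exact: le_lt_trans px xa.
    by rewrite leNgt; apply: contra pC => ->; exact: lt_le_trans pa nx'a.
  move: (bar_count _ _ _ _) => n; case: (b < y ?<= if d) => /=; last by rewrite !subrr.
  by rewrite add0n add1n ltnS subr0 mul1r.
have eqE (u v : R) : (u <= v)%R%:Z - (u < v)%R%:Z = (v == u)%:Z.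
  by rewrite le_eqVlt eq_sym; case: eqP => [->|_] /=; rewrite ?ltxx // subrr.
have eqE' (u v : R) : (v <= u)%R%:Z - (v < u)%R%:Z = (v == u)%:Z.
  by rewrite eqE eq_sym.
have := (key true true, key false true, key true false, key false false).
rewrite /graded_diagram /= -(eqE x a) -(eqE x' a) -(eqE' (t k) b) -(eqE' (t k.+1) b).
move=> [[[k1 k2] k3] k4].
transitivity ((((k < bar_count true true ((x, y) :: C) (a, b))%N%:Z -
    (k < bar_count true true ((x', y) :: C) (a, b))%N%:Z) -
   ((k < bar_count false true ((x, y) :: C) (a, b))%N%:Z -
    (k < bar_count false true ((x', y) :: C) (a, b))%N%:Z) -
   ((k < bar_count true false ((x, y) :: C) (a, b))%N%:Z -
    (k < bar_count true false ((x', y) :: C) (a, b))%N%:Z)) +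
   ((k < bar_count false false ((x, y) :: C) (a, b))%N%:Z -
    (k < bar_count false false ((x', y) :: C) (a, b))%N%:Z)); first by ring.
by rewrite k1 k2 k3 k4; ring.
Qed.

(** The [j]-th largest element of [Y], clamped between [x] and [y]; the 0-th one
    is [y]. After inserting [q], the [j+1]-st largest element is the former one,
    unless it is exceeded by both [q] and the former [j]-th one. *)
Fixpoint threshold x y (Y : seq R) (j : nat) {struct Y} : R :=
  match j, Y with
  | 0, _ => y
  | _.+1, [::] => x
  | j'.+1, q :: Y' => Num.max (threshold x y Y' j) (Num.min q (threshold x y Y' j'))
  end.

Lemma threshold_bounds x y Y j : x <= y -> x <= threshold x y Y j <= y.
Proof.
move=> xy; elim: Y j => [|q Y IH] [|j] /=; rewrite ?lexx ?xy //.
have /andP[h1 h2] := IH j.+1; have /andP[_ h3] := IH j.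
by rewrite le_max h1 ge_max h2 ge_min h3 orbT.
Qed.

Lemma thresholdP x y Y j d b : x < b ->
  (b < y ?<= if d) && (j <= count (fun q => b < q ?<= if d) Y)%N =
  (b < threshold x y Y j ?<= if d).
Proof.
move=> xb; elim: Y j => [|q Y IH] [|j] /=; rewrite ?andbT //.
  rewrite andbF; symmetry; apply/negbTE; apply/negP => /lteifW.
  by rewrite leNgt xb.
rewrite lteif_maxr lteif_minr -!IH.
set e := (b < y ?<= if d); set n := count _ Y.
case: e => /=; last by rewrite andbF.
by case: (b < q ?<= if d) => /=; rewrite ?add0n ?add1n ?ltnS ?orbF //; lia.
Qed.

(** The minimum replaces a point that would fall below the diagonal by a
    diagonal point, which is no farther away. *)
Definition strip_moves x x' (t : nat -> R) k :=
  [:: ((x, t k), (Num.min x' (t k), t k));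
      ((Num.min x' (t k.+1), t k.+1), (x, t k.+1))].

Lemma strip_transports x x' y C (t : nat -> R) k :
  x <= x' -> (forall p, p \in C -> ~~ (x < p.1 < x')) ->
  (forall j, x <= t j) ->
  (forall j d b, x < b ->
    (b < y ?<= if d) && (j <= bar_count true d C (x, b))%N = (b < t j ?<= if d)) ->
  transports (strip_moves x x' t k)
    (fun z => graded_diagram k.+1 ((x, y) :: C) z - graded_diagram k.+1 ((x', y) :: C) z).
Proof.
move=> xx' noC xt tP.
have qE j (z : R * R) : z.1 < z.2 ->
    ((Num.min x' (t j), t j) == z) = (z.1 == x') && (z.2 == t j).
  case: z => a b /= ab; rewrite xpair_eqE [b == _]eq_sym.
  case: (eqVneq (t j) b) => [tb|_]; last by rewrite !andbF.
  rewrite !andbT tb; case: leP => [_|bx']; first by rewrite eq_sym.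
  by apply/idP/idP => /eqP e; move: ab; rewrite e ?ltxx // ltNge ltW.
split; first by rewrite /valid_moves /= !xt !ge_min !lexx !orbT.
move=> z zlt; rewrite (strip_graded k zlt xx' noC tP).
case: z zlt => a b ab; rewrite /moves_boundary /= !qE // !xpair_eqE /=.
rewrite ![x == _]eq_sym ![t _ == _]eq_sym.
by case: (a == x); case: (a == x'); case: (b == t k); case: (b == t k.+1).
Qed.

(** The source of the constant: K + 1 graded diagrams change by two moves each,
    except for the last one, whose second move is trivial. *)
Lemma reach_strip K x x' y C :
  x <= x' -> x' <= y -> (forall p, p \in C -> ~~ (x < p.1 < x')) ->
  rank_le K.+1 ((x, y) :: C) ->
  graded_reach K.+1 ((x, y) :: C) ((x', y) :: C) (K.*2.+1%:R * (x' - x)).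
Proof.
move=> xx' x'y noC rk; have xy := le_trans xx' x'y.
pose t := threshold x y [seq p.2 | p <- C & p.1 <= x].
have tP j d b : x < b ->
    (b < y ?<= if d) && (j <= bar_count true d C (x, b))%N = (b < t j ?<= if d).
  move=> xb; rewrite -thresholdP // count_map count_filter.
  by congr (_ && (_ <= _)%N); apply: eq_count => p /=; rewrite andbC.
have xt j : x <= t j by have /andP[] := threshold_bounds [seq p.2 | p <- C & p.1 <= x] j xy.
(* Otherwise the moved bar and K + 1 bars of [C] contain [[x, t (K + 1))]. *)
have tK : t K.+1 = x.
  apply/eqP; rewrite eq_le xt andbT leNgt; apply/negP => xtK.
  have := tP K.+1 true _ xtK; rewrite /= lexx => /andP[ty].
  have := rk (x, t K.+1) xtK; rewrite /bar_count /= lexx ty /= add1n ltnS => h1 h2.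
  by have := leq_trans h2 h1; rewrite ltnn.
pose q j := (Num.min x' (t j), t j).
have dq j : l1_dist (x, t j) (q j) <= x' - x.
  rewrite /l1_dist /= subrr normr0 addr0 ger0_norm ?subr_ge0 ?le_min ?xx' ?xt //.
  by rewrite lerD2r ge_min lexx.
exists (strip_moves x x' t); split; first by move=> k; exact: strip_transports.
have cost_s k : moves_cost (strip_moves x x' t k) =
    l1_dist (x, t k) (q k) + l1_dist (x, t k.+1) (q k.+1).
  by rewrite !moves_cost_cons /moves_cost big_nil addr0 /= (l1_distC (q _)).
rewrite big_ord_recr /= -addn1 natrD mulrDl mul1r; apply: lerD.
  apply: (@le_trans _ _ (\sum_(k < K) ((x' - x) + (x' - x)))).
    by apply: ler_sum => k _; rewrite cost_s lerD.
  by rewrite sumr_const card_ord -mulr2n -mulrnA mul2n mulr_natl.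
rewrite cost_s (_ : q K.+1 = (x, t K.+1)); last by rewrite /q tK min_r.
by rewrite [X in _ + X](_ : _ = 0) ?addr0 // /l1_dist !subrr normr0 addr0.
Qed.

Lemma ltn_count (T : eqType) (P Q : pred T) (L : seq T) u :
  subpred P Q -> u \in L -> Q u -> ~~ P u -> (count P L < count Q L)%N.
Proof.
move=> PQ uL Qu nPu; rewrite !(permP (perm_to_rem uL)) /= Qu (negbTE nPu).
by rewrite add0n add1n ltnS sub_count.
Qed.

Lemma rank_le_shrink K p q C : p.1 <= q.1 -> q.2 <= p.2 ->
  rank_le K (p :: C) -> rank_le K (q :: C).
Proof.
move=> pq qp rk z zlt; apply: leq_trans (rk z zlt).
rewrite /bar_count /= leq_add2r.
case: (boolP (_ && _)) => // /andP[qz zq].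
by rewrite (le_trans pq qz) (le_trans zq qp).
Qed.

(** Stop at each left end of [C] met on the way; the rank bound is inherited
    since the bar only shrinks. *)
Lemma reach_left K x x' y C :
  x <= x' -> x' <= y -> rank_le K.+1 ((x, y) :: C) ->
  graded_reach K.+1 ((x, y) :: C) ((x', y) :: C) (K.*2.+1%:R * (x' - x)).
Proof.
pose btw x x' (p : R * R) := x < p.1 < x'.
have [n] := ubnP (count (btw x x') C).
elim: n x x' => // n IH x x'; rewrite ltnS => cn xx' x'y rk.
have [/hasP[p pC /andP[xp px']]|/hasPn noC] := boolP (has (btw x x') C); last first.
  exact: reach_strip.
have -> : x' - x = (p.1 - x) + (x' - p.1) by rewrite [RHS]addrC subrKA.
rewrite mulrDr; apply: (@reach_trans _ ((p.1, y) :: C)).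
  apply: IH => //; [|exact: ltW|exact: le_trans (ltW px') x'y].
  apply: leq_trans cn; apply: (@ltn_count _ _ _ _ p) => //; rewrite /btw.
  - by move=> w /= /andP[-> /lt_trans->].
  - by rewrite xp px'.
  - by rewrite ltxx andbF.
apply: IH => //; [|exact: ltW|].
  apply: leq_trans cn; apply: (@ltn_count _ _ _ _ p) => //; rewrite /btw.
  - by move=> w /= /andP[/(lt_trans xp)-> ->].
  - by rewrite xp px'.
  - by rewrite ltxx.
by apply: rank_le_shrink rk => //=; exact: ltW.
Qed.

(** Reversing the line exchanges left and right ends, and preserves [l1_dist]. *)
Definition reflect_pt p : R * R := (- p.2, - p.1).

Lemma reflect_ptK : involutive reflect_pt.
Proof. by case=> a b; rewrite /reflect_pt /= !opprK. Qed.

Lemma bar_count_reflect c d B z :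
  bar_count c d (map reflect_pt B) z = bar_count d c B (reflect_pt z).
Proof.
rewrite /bar_count count_map; apply: eq_count => p /=.
rewrite andbC; congr andb.
  by case: d; [exact: lerNr|exact: ltrNr].
by case: c; [exact: lerNl|exact: ltrNl].
Qed.

Lemma graded_reflect k B z :
  graded_diagram k (map reflect_pt B) z = graded_diagram k B (reflect_pt z).
Proof. by rewrite /graded_diagram !bar_count_reflect; ring. Qed.

Lemma reflect_lt z : ((reflect_pt z).1 < (reflect_pt z).2) = (z.1 < z.2).
Proof. by rewrite /= ltrN2. Qed.

Lemma reach_reflect K B B' r :
  graded_reach K (map reflect_pt B) (map reflect_pt B') r -> graded_reach K B B' r.
Proof.
move=> [s [trs cs]].
pose refl2 (m : (R * R) * (R * R)) := (reflect_pt m.1, reflect_pt m.2).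
exists (fun k => map refl2 (s k)); split.
  move=> k; have [vs es] := trs k; split.
    rewrite /valid_moves all_map; apply: sub_all vs => m /= /andP[h1 h2].
    by rewrite !lerN2 h1 h2.
  move=> z zlt; rewrite -[z]reflect_ptK -!(graded_reflect _ _ (reflect_pt z)) es ?reflect_lt //.
  rewrite /moves_boundary -!map_comp !count_map.
  by congr (Posz _ - Posz _); apply: eq_count => m /=;
     rewrite (inj_eq (can_inj reflect_ptK)) ?reflect_ptK // -{1}[z]reflect_ptK
       (inj_eq (can_inj reflect_ptK)).
rewrite (eq_bigr (fun k : 'I_K => moves_cost (s k))) // => k _.
rewrite /moves_cost big_map; apply: eq_bigr => m _ /=.
by rewrite /l1_dist /= !opprK addrC; congr (_ + _); rewrite distrC addrC.
Qed.

Lemma reach_right K x y y' C :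
  x <= y' -> y' <= y -> rank_le K.+1 ((x, y) :: C) ->
  graded_reach K.+1 ((x, y) :: C) ((x, y') :: C) (K.*2.+1%:R * (y - y')).
Proof.
move=> xy' y'y rk; apply: reach_reflect => /=.
rewrite (_ : y - y' = - y' - (- y)); last by rewrite opprK addrC.
apply: reach_left; rewrite ?lerN2 //.
move=> z zlt; rewrite -[_ :: _]/(map reflect_pt ((x, y) :: C)).
by rewrite bar_count_reflect rk // reflect_lt.
Qed.

Lemma reach_shrink K z w C :
  z.1 <= w.1 -> w.1 <= w.2 -> w.2 <= z.2 -> rank_le K.+1 (z :: C) ->
  graded_reach K.+1 (z :: C) (w :: C) (K.*2.+1%:R * l1_dist z w).
Proof.
case: z w => x y [x' y'] /= xx' x'y' y'y rk.
rewrite /l1_dist /= ger0_norm ?subr_ge0 // ler0_norm ?subr_le0 // opprB mulrDr.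
apply: (@reach_trans _ ((x', y) :: C)).
  by apply: reach_left => //; exact: le_trans y'y.
by apply: reach_right => //; exact: rank_le_shrink rk.
Qed.

Definition shrinking (s : seq ((R * R) * (R * R))) : bool :=
  all (fun m => [&& m.1.1 <= m.2.1, m.2.1 <= m.2.2 & m.2.2 <= m.1.2]) s.

Lemma reach_shrinking K s C :
  shrinking s -> rank_le K.+1 (map fst s ++ C) ->
  graded_reach K.+1 (map fst s ++ C) (map snd s ++ C) (K.*2.+1%:R * moves_cost s).
Proof.
have midP B w D : perm_eq (B ++ w :: D) (w :: B ++ D).
  by rewrite -cat1s perm_catCA.
elim: s C => [|[z w] s IH] C /=.
  by move=> _ _; apply: same_counts_reach; rewrite // mulr_ge0 ?moves_cost_ge0.
move=> /andP[/and3P[zw1 w12 wz2] ss] rk.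
rewrite moves_cost_cons mulrDr; apply: (@reach_trans _ (w :: map fst s ++ C)).
  exact: reach_shrink.
rewrite -[_ * _]add0r; apply: (@reach_trans _ (map fst s ++ (w :: C))).
  by apply: same_counts_reach => //; apply: bar_count_perm; rewrite perm_sym midP.
rewrite -[_ * _]addr0; apply: (@reach_trans _ (map snd s ++ (w :: C))).
  apply: IH => //; apply: same_counts_rank_le (rank_le_shrink zw1 wz2 rk).
  by apply: bar_count_perm; rewrite perm_sym midP.
by apply: same_counts_reach => //; apply: bar_count_perm; rewrite midP.
Qed.

(** The intersection of the intervals [z] and [w]; when it is empty, a diagonal
    point to which [z] can retract. *)
Definition meet_bar z w : R * R :=
  if Num.max z.1 w.1 <= Num.min z.2 w.2
  then (Num.max z.1 w.1, Num.min z.2 w.2) else (z.1, z.1).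

Lemma meet_bar_shrinking z w : z.1 <= z.2 ->
  [&& z.1 <= (meet_bar z w).1, (meet_bar z w).1 <= (meet_bar z w).2 &
      (meet_bar z w).2 <= z.2].
Proof.
rewrite /meet_bar => zle; case: ifP => [h|_] /=; last by rewrite lexx zle.
by rewrite h le_max lexx ge_min lexx.
Qed.

(** This is where the l1 norm matters: the detour through the intersection is
    free, and for disjoint intervals the l1 distance is at least the sum of the
    lengths. *)
Lemma meet_bar_cost z w : z.1 <= z.2 -> w.1 <= w.2 ->
  l1_dist z (meet_bar z w) + l1_dist w (meet_bar w z) <= l1_dist z w.
Proof.
move=> zle wle; have := meet_bar_shrinking w zle; have := meet_bar_shrinking z wle.
move=> /and3P[w1 _ w2] /and3P[z1 _ z2]; rewrite /l1_dist.
rewrite (ger0_norm (_ : 0 <= (meet_bar z w).1 - _)) ?subr_ge0 //.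
rewrite (ger0_norm (_ : 0 <= (meet_bar w z).1 - _)) ?subr_ge0 //.
rewrite (ler0_norm (_ : (meet_bar z w).2 - _ <= 0)) ?subr_le0 //.
rewrite (ler0_norm (_ : (meet_bar w z).2 - _ <= 0)) ?subr_le0 //.
have n1 := ler_norm (w.1 - z.1); have n2 := ler_norm (w.2 - z.2).
have := ler_norm (z.1 - w.1); have := ler_norm (z.2 - w.2).
rewrite (distrC z.1) (distrC z.2) => n3 n4.
clear z1 z2 w1 w2; move: n1 n2 n3 n4.
move: (`|_|) (`|_|) => u v; rewrite /meet_bar.
rewrite [Num.max w.1 _]maxC [Num.min w.2 _]minC.
case: (leP z.1 w.1) => h1; case: (leP z.2 w.2) => h2; case: ifP => /= h3; move=> *;
  try (move/negbT: h3; rewrite -ltNge => h3); lra.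
Qed.

Lemma meet_bar_counts s :
  same_counts [seq meet_bar m.1 m.2 | m <- s] [seq meet_bar m.2 m.1 | m <- s].
Proof.
move=> c d z zlt; elim: s => //= m s IH.
rewrite /bar_count /= -!/(bar_count _ _ _ _) IH; congr ((nat_of_bool _) + _)%N.
rewrite /meet_bar [Num.max m.2.1 _]maxC [Num.min m.2.2 _]minC.
case: ifP => // _ /=.
have diag u : (u < z.1 ?<= if c) && (z.2 < u ?<= if d) = false.
  apply/negP => /andP[/lteifW h1 /lteifW h2].
  by have := le_trans h2 h1; rewrite leNgt zlt.
by rewrite !diag.
Qed.

(** Shrinking first and growing afterwards never exceeds the rank of the two
    ends, whereas following the moves one at a time could. *)
Lemma graded_stability K s :
  valid_moves s -> rank_le K.+1 (map fst s) -> rank_le K.+1 (map snd s) ->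
  graded_reach K.+1 (map fst s) (map snd s) (K.*2.+1%:R * moves_cost s).
Proof.
move=> vs r1 r2.
pose s1 := [seq (m.1, meet_bar m.1 m.2) | m <- s].
pose s2 := [seq (m.2, meet_bar m.2 m.1) | m <- s].
have sh1 : shrinking s1.
  rewrite /shrinking all_map; apply: sub_all vs => m /= /andP[h _].
  exact: meet_bar_shrinking.
have sh2 : shrinking s2.
  rewrite /shrinking all_map; apply: sub_all vs => m /= /andP[_ h].
  exact: meet_bar_shrinking.
have f1 : map fst s1 = map fst s by rewrite -map_comp.
have f2 : map fst s2 = map snd s by rewrite -map_comp.
have := @reach_shrinking K s1 [::] sh1; have := @reach_shrinking K s2 [::] sh2.
rewrite !cats0 f1 f2 => /(_ r2) R2 /(_ r1) R1.
have mid : graded_reach K.+1 (map snd s1) (map snd s2) 0.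
  by apply: same_counts_reach => //; rewrite -!map_comp; exact: meet_bar_counts.
apply: reach_le (reach_trans R1 (reach_trans mid (reach_sym R2))).
rewrite add0r -mulrDr ler_wpM2l // /moves_cost !big_map -big_split /=.
rewrite big_seq [leRHS]big_seq; apply: ler_sum => m /(allP vs)/andP[h1 h2].
exact: meet_bar_cost.
Qed.

End Barcodes.
(** * The two inequalities for diagrams that come from barcodes *)

Section DiagramInequalities.
Context {R : realType}.
Implicit Types (B : seq (R * R)) (z : R * R).

Lemma represents_finite_support (A : R * R -> int) (L : seq (R * R)) :
  (forall z, z.1 < z.2 -> 0 <= A z) ->
  (forall z, z.1 < z.2 -> A z != 0 -> z \in L) ->
  exists LA, represents A LA.
Proof.
move=> A0 AL; have [u uP] := multiset_of_function (fun z => `|A z|%N) (undup_uniq L).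
exists u => z zlt; rewrite uP mem_undup; case: ifPn => [_|zL].
  by rewrite gez0_abs // A0.
by apply/eqP; apply: contraNT zL; exact: AL.
Qed.

Lemma W11_signed_kr_norm (A A' : R * R -> int) (L L' : seq (R * R)) :
  (forall z, z.1 < z.2 -> A z != 0 -> z \in L) ->
  (forall z, z.1 < z.2 -> A' z != 0 -> z \in L') ->
  W11_signed A A' = kr_norm (fun z => A z - A' z).
Proof.
have ge0 (U V : R * R -> int) z : 0 <= pos_part U z + neg_part V z.
  by rewrite addr_ge0 // le_max lexx orbT.
have supp (U V : R * R -> int) (LU LV : seq (R * R)) :
    (forall z, z.1 < z.2 -> U z != 0 -> z \in LU) ->
    (forall z, z.1 < z.2 -> V z != 0 -> z \in LV) ->
    exists LA, represents (fun z => pos_part U z + neg_part V z) LA.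
  move=> UL VL; apply: (@represents_finite_support _ (LU ++ LV)) => // z zlt.
  rewrite mem_cat; apply: contraNT; rewrite negb_or => /andP[/(contraNN (UL z zlt))].
  rewrite negbK => /eqP U0 /(contraNN (VL z zlt)); rewrite negbK => /eqP V0.
  by rewrite /pos_part /neg_part U0 V0 oppr0 maxxx.
move=> AL AL'; have [LA rA] := supp _ _ _ _ AL AL'; have [LA' rA'] := supp _ _ _ _ AL' AL.
rewrite /W11_signed (W11_kr_norm rA rA'); apply: eq_kr_norm => z _.
rewrite /pos_part /neg_part; move: (A z) (A' z) => a b.
by case: (leP a 0) => ha; case: (leP b 0) => hb;
   case: (leP (- a) 0) => hc; case: (leP (- b) 0) => hd; lia.
Qed.

Lemma bar_count_le c d B z : (bar_count c d B z <= bar_count true true B z)%N.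
Proof. by apply: sub_count => p /= /andP[/lteifW -> /lteifW ->]. Qed.

(** If no bar starts at [z.1], or none ends at [z.2], the four terms cancel in pairs. *)
Lemma graded_support k B z : graded_diagram k B z != 0 ->
  z \in [seq (x, y) | x <- map fst B, y <- map snd B].
Proof.
move=> gz; apply/allpairsP; exists z; split; last by case: z {gz}.
- apply: contraNT gz => zB.
  have e d : bar_count true d B z = bar_count false d B z.
    apply: eq_in_count => p pB /=; rewrite le_eqVlt; case: eqP => // pz.
    by case/negP: zB; rewrite -pz map_f.
  by rewrite /graded_diagram !e; apply/eqP; ring.
- apply: contraNT gz => zB.
  have e c : bar_count c true B z = bar_count c false B z.
    apply: eq_in_count => p pB /=; rewrite [z.2 <= _]le_eqVlt; case: eqP => // pz.
    by case/negP: zB; rewrite pz map_f.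
  by rewrite /graded_diagram !e; apply/eqP; ring.
Qed.

Lemma count_mem_bar_count B z :
  (count_mem z B)%:Z = (bar_count true true B z)%:Z - (bar_count false true B z)%:Z
    - (bar_count true false B z)%:Z + (bar_count false false B z)%:Z.
Proof.
elim: B => [|p B IH]; first by [].
rewrite /bar_count /= -!/(bar_count _ _ _ _) !PoszD IH.
have -> : (p == z) = (p.1 == z.1) && (z.2 == p.2).
  by case: p z {IH} => a b [x y]; rewrite xpair_eqE [y == _]eq_sym.
rewrite [p.1 <= _]le_eqVlt [z.2 <= _]le_eqVlt.
have : (p.1 == z.1) ==> ~~ (p.1 < z.1) by apply/implyP => /eqP->; rewrite ltxx.
have : (z.2 == p.2) ==> ~~ (z.2 < p.2) by apply/implyP => /eqP->; rewrite ltxx.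
case: (p.1 == z.1); case: (p.1 < z.1); case: (z.2 == p.2); case: (z.2 < p.2);
  move=> //= _ _; ring.
Qed.

(** A rank bounded by [K] is the sum of its [K] level indicators. *)
Lemma sum_threshold K n : (n <= K)%N -> \sum_(1 <= k < K.+1) (k <= n)%N%:Z = n%:Z.
Proof.
move=> nK; rewrite big_add1 /= (big_cat_nat _ nK) //= [X in _ + X]big_nat_cond.
rewrite [X in _ + X]big1 ?addr0; last first.
  by move=> k; rewrite andbT => /andP[nk _]; rewrite ltnNge nk.
rewrite big_nat_cond (eq_bigr (fun=> 1)); last first.
  by move=> k; rewrite andbT => /andP[_ ->].
by rewrite -big_nat_cond sumr_const_nat subn0 natz.
Qed.

Lemma sum_graded K B z : rank_le K B -> z.1 < z.2 ->
  \sum_(1 <= k < K.+1) graded_diagram k B z = (count_mem z B)%:Z.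
Proof.
move=> rk zlt; rewrite count_mem_bar_count.
rewrite big_split /= !sumrB !sum_threshold //;
  by rewrite (leq_trans (bar_count_le _ _ _ _)) // rk.
Qed.

Section TwoDiagrams.
Variables (D E : R * R -> int) (Dk Ek : nat -> R * R -> int).
Variables (B B' : seq (R * R)) (K : nat).
Hypotheses (repD : represents D B) (repE : represents E B').
Hypotheses (rkB : rank_le K B) (rkB' : rank_le K B').
Hypothesis gradedD : forall k z, (0 < k)%N -> z.1 < z.2 -> Dk k z = graded_diagram k B z.
Hypothesis gradedE : forall k z, (0 < k)%N -> z.1 < z.2 -> Ek k z = graded_diagram k B' z.

Lemma W11_signed_graded k : (0 < k)%N ->
  W11_signed (Dk k) (Ek k) = kr_norm (fun z => graded_diagram k B z - graded_diagram k B' z).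
Proof.
move=> k0.
rewrite (@W11_signed_kr_norm _ _ [seq (x, y) | x <- map fst B, y <- map snd B]
  [seq (x, y) | x <- map fst B', y <- map snd B']).
- by apply: eq_kr_norm => z zlt; rewrite gradedD // gradedE.
- by move=> z zlt; rewrite gradedD //; exact: graded_support.
- by move=> z zlt; rewrite gradedE //; exact: graded_support.
Qed.

Lemma W11_le_sum_graded :
  (W11 D E <= \sum_(1 <= k < K.+1) W11_signed (Dk k) (Ek k))%E.
Proof.
rewrite (W11_kr_norm repD repE) big_nat_cond.
rewrite (eq_bigr (fun k => kr_norm (fun z => graded_diagram k B z - graded_diagram k B' z)));
  last by move=> k; rewrite andbT => /andP[k0 _]; rewrite W11_signed_graded.
rewrite -big_nat_cond; apply: le_trans (kr_norm_sum _ _).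
rewrite (@eq_kr_norm _ _ (fun z => \sum_(1 <= k < K.+1) (graded_diagram k B z - graded_diagram k B' z))) //.
by move=> z zlt; rewrite sumrB !sum_graded // repD // repE.
Qed.

Lemma sum_graded_le_W11 :
  (\sum_(1 <= k < K.+1) W11_signed (Dk k) (Ek k) <= (2 * K%:R - 1)%:E * W11 D E)%E.
Proof.
case: K rkB rkB' W11_le_sum_graded => [|K'] rk rk'.
  rewrite big_geq // => W0; have -> : W11 D E = 0%E.
    by apply/eqP; rewrite eq_le W0 (W11_kr_norm repD repE) kr_norm_ge0.
  by rewrite mule0.
(* Any list of moves for [D - E] can be given the exact marginals [D] and [E],
   so that it moves one barcode to the other. *)
move=> _; have -> : 2 * K'.+1%:R - 1 = K'.*2.+1%:R :> R.
  by rewrite -addn1 -[X in _ = X%:R]addn1 !natrD -muln2 natrM; ring.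
have K0 : 0 < K'.*2.+1%:R :> R by rewrite ltr0n.
rewrite -lee_pdivrMl // (W11_kr_norm repD repE).
apply: le_ereal_inf_tmp => _ [s trs <-].
have [t [vt ct tD tE]] := transports_exact repD repE trs.
have BD := represents_same_counts repD tD; have BE := represents_same_counts repE tE.
have [u [tru cu]] := graded_stability vt (same_counts_rank_le BD rk)
  (same_counts_rank_le BE rk').
rewrite lee_pdivrMl //; apply: (@le_trans _ _ (\sum_(k < K'.+1) moves_cost (u k))%:E).
  rewrite big_add1 /= big_mkord -sumEFin; apply: lee_sum => k _.
  rewrite W11_signed_graded //; apply: kr_norm_le.
  apply: eq_transports (tru k) => z zlt.
  by rewrite -(same_counts_graded _ BD) // -(same_counts_graded _ BE).
by rewrite -EFinM lee_fin (le_trans cu) // ler_wpM2l.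
Qed.

End TwoDiagrams.
End DiagramInequalities.
(** * Moebius inversion on the poset of intervals *)

Section MoebiusInversion.
Context (d : Order.disp_t) (T : finPOrderType d).

Lemma sum_mobius (x z : T) : (x <= z)%O ->
  \sum_(y : T | (x <= y)%O && (y <= z)%O) mobius x y = (x == z)%:Z.
Proof.
move=> xz; rewrite (bigD1 z) /=; last by rewrite xz lexx.
have [<-|nxz] := eqVneq x z.
  rewrite mobius_xx big1 ?addr0 // => y /andP[/andP[xy yx] /eqP[]].
  by apply/le_anti; rewrite yx xy.
rewrite mobius_lt ?lt_neqAle ?nxz //.
rewrite [X in _ + X](eq_bigl (fun y => (x <= y)%O && (y < z)%O)) ?addNr //.
by move=> y /=; rewrite lt_neqAle andbAC -andbA.
Qed.

(** As [h] is given as a sum over upper sets, exchanging the two summations leaves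
    the sums of [mobius x] over the interval from [x] to [z], which its recursion
    makes vanish unless x = z. *)
Lemma mobius_inversion (h g : T -> int) :
  (forall x, h x = \sum_(y : T | (x <= y)%O) g y) ->
  forall x, mobius_conv h x = g x.
Proof.
move=> hE x; rewrite /mobius_conv.
under eq_bigr do rewrite hE mulr_sumr.
rewrite (exchange_big_dep (fun z => x <= z)%O) /=; last first.
  by move=> y z; exact: le_trans.
rewrite (bigD1 x) //= [X in _ + X]big1 ?addr0 => [|z /andP[xz zx]].
  by rewrite -mulr_suml sum_mobius // eqxx mul1r.
by rewrite -mulr_suml sum_mobius // eq_sym (negbTE zx) mul0r.
Qed.

End MoebiusInversion.

Section IntervalSums.
Variable n : nat.
Implicit Types (I J : itvs n) (Phi : nat -> nat -> int).

Definition mixed_diff Phi (i j : nat) : int :=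
  Phi i.+1 j - Phi i j - Phi i.+1 j.+1 + Phi i j.+1.

Lemma sum_itvs_ge I (f : nat -> nat -> int) :
  \sum_(J : itvs n | (I <= J)%O) f (itv_lo J) (itv_hi J) =
  \sum_(0 <= i < (itv_lo I).+1) \sum_(itv_hi I <= j < n) f i j.
Proof.
rewrite big_mkord (big_ord_widen n (fun i => \sum_(itv_hi I <= j < n) f i j)) //.
under [RHS]eq_bigr do rewrite big_geq_mkord.
rewrite pair_big_dep /=.
rewrite (reindex_onto (@itv_ends n) (fun p => insubd I p)) /=.
  apply: eq_bigl => J; rewrite valKd eqxx andbT.
  by rewrite [LHS]itvs_leE ltnS.
move=> [i j] /=; rewrite ltnS => /andP[iI Ij]; rewrite insubdK //.
rewrite ltEord; apply: leq_ltn_trans iI _.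
by apply: leq_trans Ij; have := itv_ends_lt I; rewrite ltEord.
Qed.

(** The intervals containing [I] form a rectangle, over which a mixed difference
    telescopes to its four corners, three of which vanish. *)
Lemma sum_mixed_diff I Phi :
  (forall j, Phi 0%N j = 0) -> (forall i, Phi i n = 0) ->
  \sum_(J : itvs n | (I <= J)%O) mixed_diff Phi (itv_lo J) (itv_hi J) =
  Phi (itv_lo I).+1 (itv_hi I).
Proof.
move=> Phi0 Phin; rewrite sum_itvs_ge.
transitivity (\sum_(0 <= i < (itv_lo I).+1)
    (Phi i.+1 (itv_hi I) - Phi i (itv_hi I))).
  apply: eq_bigr => i _; pose G j := Phi i j - Phi i.+1 j.
  rewrite (eq_bigr (fun j => G j.+1 - G j)); last first.
    by move=> j _; rewrite /mixed_diff /G; ring.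
  by rewrite telescope_sumr ?(ltnW (ltn_ord _)) // /G !Phin; ring.
by rewrite telescope_sumr // Phi0 subr0.
Qed.

Lemma mobius_conv_itvs (h : itvs n -> int) Phi :
  (forall j, Phi 0%N j = 0) -> (forall i, Phi i n = 0) ->
  (forall I, h I = Phi (itv_lo I).+1 (itv_hi I)) ->
  forall I, mobius_conv h I = mixed_diff Phi (itv_lo I) (itv_hi I).
Proof.
move=> Phi0 Phin hE I.
rewrite (@mobius_inversion _ _ h (fun I => mixed_diff Phi (itv_lo I) (itv_hi I))) //.
by move=> J; rewrite sum_mixed_diff.
Qed.

End IntervalSums.

(** * Ranks of persistence modules *)

Section Ranks.
Context (F : fieldType).

(** Extending the rank by 0 dispenses with the proof that the end points are ordered. *)
Definition rk (d : Order.disp_t) (P : porderType d) (M : pmod P F) (a b : P) : nat :=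
  if @idP (a <= b)%O is ReflectT ab then pm_rank M ab else 0%N.

Lemma rkE (d : Order.disp_t) (P : porderType d) (M : pmod P F) (a b : P)
  (ab : (a <= b)%O) : rk M a b = pm_rank M ab.
Proof.
by rewrite /rk; case: {-}_ / idP => [ab'|//]; rewrite (bool_irrelevance ab' ab).
Qed.

(** Frobenius' inequality. With U contained in V the images at [c] of the maps
    from [a] and from [b], the kernel of the map from [c] to [e] meets U in a
    subspace of its intersection with V, so U loses no more rank than V. *)
Lemma rk_frobenius (d : Order.disp_t) (P : porderType d) (M : pmod P F)
    (a b c e : P) : (a <= b)%O -> (b <= c)%O -> (c <= e)%O ->
  (rk M a c + rk M b e <= rk M b c + rk M a e)%N.
Proof.
move=> ab bc ce; have ac := le_trans ab bc; have be := le_trans bc ce.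
have ae := le_trans ac ce.
rewrite (rkE M ac) (rkE M be) (rkE M bc) (rkE M ae) /pm_rank.
rewrite (pm_comp M bc ce be) (pm_comp M ac ce ae) !limg_comp.
set h := pm_map M ce; set U := limg (pm_map M ac); set V := limg (pm_map M bc).
have UV : (U <= V)%VS.
  by rewrite /U (pm_comp M ab bc ac) limg_comp limgS // subvf.
have := dimvS (capvS UV (subvv (lker h))).
by have := limg_ker_dim h U; have := limg_ker_dim h V; lia.
Qed.

Lemma rk_iso (d : Order.disp_t) (P : porderType d) (M N : pmod P F) (a b : P) :
  pm_iso M N -> rk M a b = rk N a b.
Proof.
move=> [f [fbij fnat]]; rewrite /rk; case: {-}_ / idP => // ab.
have inj c : lker (f c) = 0%VS.
  apply/eqP/lker0P; exact: bij_inj (fbij c).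
have surj c : limg (f c) = fullv.
  apply/vspaceP => v; rewrite memvf; have [g _ fg] := fbij c.
  by rewrite -(fg v) memv_img // memvf.
rewrite /pm_rank -(limg_dim_eq (f := f b)) ?inj ?capv0 //.
by rewrite -limg_comp fnat limg_comp surj.
Qed.

Lemma rk_ext0 (d d' : Order.disp_t) (P : porderType d) (Q : porderType d')
    (M : pmod P F) (f : Q -> option P) fm fc (a b : Q) : (a <= b)%O ->
  rk (@ext0 d d' P Q F M f fm fc) a b =
  match f a, f b with Some i, Some j => rk M i j | _, _ => 0%N end.
Proof.
move=> ab; rewrite (rkE _ ab) /pm_rank /=; move: (fun i j => _).
case: (f a) (f b) => [i|] [j|] le_ij /=.
- by rewrite (rkE M (le_ij i j erefl erefl)).
- by rewrite lim0g dimv0.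
- by rewrite lim0g dimv0.
- by rewrite lim0g dimv0.
Qed.

Lemma rk_hat m (M : pmod 'I_m.+1 F) (i j : 'I_m.+2) : (i <= j)%O ->
  rk (hat M) i j = if (j < m.+1)%N then rk M (inord i) (inord j) else 0%N.
Proof.
move=> ij; rewrite rk_ext0 // /hat_index.
case: (insubP _ (j : nat)) => [j' jm jE|nj]; last first.
  by rewrite (negbTE nj); case: insub.
case: insubP => [i' _ iE|/negP[]]; last exact: leq_ltn_trans ij jm.
by rewrite jm -iE -jE !inord_val.
Qed.

(** A copy of the module with a zero space on either side, shifted by one, so
    that neighbours of an interval always exist. *)
Definition pad_index m (s : nat) : option 'I_m.+1 :=
  if s is s'.+1 then insub s' else None.

Lemma pad_index_mono m (a b : nat) (i j : 'I_m.+1) :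
  (a <= b)%O -> pad_index m a = Some i -> pad_index m b = Some j -> (i <= j)%O.
Proof.
case: a b => [|a] [|b] //= ab; case: insubP => // i' _ ia [<-].
by case: insubP => // j' _ jb [<-]; rewrite leEord ia jb.
Qed.

Lemma pad_index_conv m (a b c : nat) :
  (a <= b)%O -> (b <= c)%O -> pad_index m a -> pad_index m c -> pad_index m b.
Proof.
case: a b c => [|a] [|b] [|c] //= _ bc _; case: insubP => // k cm _ _; move: bc.
by rewrite leEnat ltnS => bc; rewrite insubT // (leq_ltn_trans bc cm).
Qed.

Definition pad m (M : pmod 'I_m.+1 F) : pmod nat F :=
  ext0 M (@pad_index_mono m) (@pad_index_conv m).

Lemma rk_pad0 m (M : pmod 'I_m.+1 F) t : rk (pad M) 0%N t = 0%N.
Proof. by rewrite rk_ext0. Qed.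

Lemma rk_pad_last m (M : pmod 'I_m.+1 F) s : rk (pad M) s m.+2 = 0%N.
Proof.
have [sm|nsm] := boolP (s <= m.+2)%O; last first.
  by rewrite /rk; case: {-}_ / idP => // h; rewrite h in nsm.
by rewrite rk_ext0 //= [insub m.+1]insubF ?ltnn //; case: pad_index.
Qed.

(** The right end of a half-open interval points one past the last index it
    contains, which cancels the shift; the left end does not. *)
Lemma Rank_pad m (M : pmod 'I_m.+1 F) (I : itvs m.+2) :
  Rank M I = rk (pad M) (itv_lo I).+1 (itv_hi I).
Proof.
have lohi : (itv_lo I < itv_hi I)%N by have := itv_ends_lt I; rewrite ltEord.
have hi0 : (0 < itv_hi I)%N by exact: leq_ltn_trans lohi.
have him : ((itv_hi I).-1 < m.+1)%N by rewrite -ltnS prednK.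
have lom : (itv_lo I < m.+1)%N by apply: leq_ltn_trans him; rewrite -ltnS prednK.
rewrite -[in RHS](prednK hi0) rk_ext0 /= ?insubT ?leEnat ?prednK //=.
rewrite /Rank -rkE; congr rk; apply: val_inj; exact: inordK.
Qed.

Lemma PD_mixed_diff m (M : pmod 'I_m.+1 F) (I : itvs m.+2) :
  PD M I = mixed_diff (fun s t => (rk (pad M) s t)%:Z) (itv_lo I) (itv_hi I).
Proof.
apply: (@mobius_conv_itvs _ _ (fun s t => (rk (pad M) s t)%:Z)) => [j|i|J].
- by rewrite rk_pad0.
- by rewrite rk_pad_last.
- by rewrite Rank_pad.
Qed.

Lemma sum_PD m (M : pmod 'I_m.+1 F) (I : itvs m.+2) :
  \sum_(J : itvs m.+2 | (I <= J)%O) PD M J = (Rank M I)%:Z.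
Proof.
under eq_bigr do rewrite PD_mixed_diff.
rewrite sum_mixed_diff; last by move=> i; rewrite rk_pad_last.
  by rewrite Rank_pad.
by move=> j; rewrite rk_pad0.
Qed.

(** The mixed difference is the defect in Frobenius' inequality. *)
Lemma PD_ge0 m (M : pmod 'I_m.+1 F) (I : itvs m.+2) : 0 <= PD M I.
Proof.
have lohi : (itv_lo I < itv_hi I)%N by have := itv_ends_lt I; rewrite ltEord.
have := @rk_frobenius _ _ (pad M) _ _ _ _ (leqnSn (itv_lo I)) lohi
  (leqnSn (itv_hi I)).
by rewrite PD_mixed_diff /mixed_diff; lia.
Qed.

End Ranks.

(** * The barcode of a tame module *)

Section Barcode.
Context (F : fieldType) (R : realType) (m : nat) (M : pmod 'I_m.+1 F).
Context (iota : 'I_m.+2 -> R).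
Hypothesis iota_le : {mono iota : i j / (i <= j)%O}.

Let iota_lt : {mono iota : i j / (i < j)%O}.
Proof. exact: leW_mono iota_le. Qed.

Let iota_inj : injective iota.
Proof. exact: inc_inj iota_le. Qed.

Definition bar_pt (I : itvs m.+2) : R * R := (iota (itv_lo I), iota (itv_hi I)).

Lemma bar_pt_inj : injective bar_pt.
Proof.
move=> I J [/iota_inj lo_eq /iota_inj hi_eq]; apply: val_inj => /=.
rewrite [itv_ends I]surjective_pairing [itv_ends J]surjective_pairing.
by congr pair; [exact: lo_eq|exact: hi_eq].
Qed.

Lemma push_diagram_bar_pt (h : itvs m.+2 -> int) I : push_diagram iota h (bar_pt I) = h I.
Proof.
rewrite /push_diagram; case: pickP => [J /eqP/bar_pt_inj -> //|/(_ I)].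
by rewrite eqxx.
Qed.

Lemma push_diagram_out (h : itvs m.+2 -> int) z :
  (forall I, z <> bar_pt I) -> push_diagram iota h z = 0.
Proof.
by move=> zI; rewrite /push_diagram; case: pickP => // J /eqP zJ; case: (zI J).
Qed.

Variable Bi : seq (itvs m.+2).
Let B := map bar_pt Bi.

(** Counting with indices turns strict and large inequalities into a shift by one. *)
Definition index_count (s t : nat) : nat :=
  count (fun J : itvs m.+2 => (itv_lo J < s)%N && (t <= itv_hi J)%N) Bi.

Lemma bar_count_index c d (I : itvs m.+2) :
  bar_count c d B (bar_pt I) =
  index_count (if c then (itv_lo I).+1 else itv_lo I)
    (if d then nat_of_ord (itv_hi I) else (itv_hi I).+1).
Proof.
rewrite /bar_count count_map; apply: eq_count => J /=.
congr andb; first by case: c => /=; rewrite ?iota_le ?iota_lt ?ltEord ?leEord ?ltnS.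
by case: d => /=; rewrite ?iota_le ?iota_lt ?ltEord ?leEord.
Qed.

Lemma graded_bar_pt k (I : itvs m.+2) : graded_diagram k B (bar_pt I) =
  mixed_diff (fun s t => (k <= index_count s t)%N%:Z) (itv_lo I) (itv_hi I).
Proof. by rewrite /graded_diagram !bar_count_index. Qed.

Lemma count_mem_bar_pt (I : itvs m.+2) : (count_mem (bar_pt I) B)%:Z =
  mixed_diff (fun s t => (index_count s t)%:Z) (itv_lo I) (itv_hi I).
Proof. by rewrite count_mem_bar_count !bar_count_index. Qed.

Lemma index_count0 t : index_count 0 t = 0%N.
Proof. by rewrite /index_count (eq_count (a2 := pred0)) ?count_pred0. Qed.

Lemma index_count_last s : index_count s m.+2 = 0%N.
Proof.
rewrite /index_count (eq_count (a2 := pred0)) ?count_pred0 // => J /=.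
by rewrite [(m.+2 <= _)%N]leqNgt ltn_ord andbF.
Qed.

Lemma out_bar_pt z : z.1 < z.2 -> (forall I, z <> bar_pt I) ->
  z \notin [seq (x, y) | x <- map fst B, y <- map snd B].
Proof.
move=> zlt zI; apply/negP => /allpairsP[[x y] /= []].
move=> /mapP[_ /mapP[I _ ->] ->] /mapP[_ /mapP[J _ ->] ->] zE.
move: zlt; rewrite zE /= iota_lt => IJ.
exact: (zI (@Itv m.+2 (itv_lo I, itv_hi J) IJ)).
Qed.

Hypothesis RankE : forall I, Rank M I = count (fun J => (I <= J)%O) Bi.

Lemma Rank_index_count I : Rank M I = index_count (itv_lo I).+1 (itv_hi I).
Proof.
rewrite RankE; apply: eq_count => J.
by rewrite [LHS]itvs_leE !leEord ltnS.
Qed.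

Lemma persistence_diagram_barcode : represents (push_diagram iota (PD M)) B.
Proof.
move=> z zlt; have [[I ->]|noI] := pselect (exists I, z = bar_pt I).
  rewrite push_diagram_bar_pt count_mem_bar_pt.
  apply: (@mobius_conv_itvs _ _ (fun s t => (index_count s t)%:Z)) => [j|i|J].
  - by rewrite index_count0.
  - by rewrite index_count_last.
  - by rewrite Rank_index_count.
have zI I : z <> bar_pt I by move=> zI; case: noI; exists I.
rewrite push_diagram_out // (count_memPn _) //.
by apply/negP => /mapP[I _ /zI].
Qed.

Lemma graded_diagram_barcode k z : (0 < k)%N -> z.1 < z.2 ->
  push_diagram iota (PDk M k) z = graded_diagram k B z.
Proof.
move=> k0 zlt; have [[I ->]|noI] := pselect (exists I, z = bar_pt I).
  rewrite push_diagram_bar_pt graded_bar_pt.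
  apply: (@mobius_conv_itvs _ _ (fun s t => (k <= index_count s t)%N%:Z)) => [j|i|J].
  - by rewrite index_count0 leqNgt k0.
  - by rewrite index_count_last leqNgt k0.
  - by rewrite Rank_index_count; case: leqP.
have zI I : z <> bar_pt I by move=> zI; case: noI; exists I.
rewrite push_diagram_out //; apply/esym/eqP; apply: contraNT (out_bar_pt zlt zI).
exact: graded_support.
Qed.

(** The bars containing [z] also contain the smallest interval of the grid
    around [z], where the rank of the module counts them. *)
Lemma barcode_rank_le K : (forall I, (Rank M I <= K)%N) -> rank_le K B.
Proof.
move=> rk z zlt.
have [/hasP[J0 _ /andP[/= J0l J0r]]|] := boolP (has (fun J : itvs m.+2 =>
    (iota (itv_lo J) <= z.1) && (z.2 <= iota (itv_hi J))) Bi); last first.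
  by rewrite has_count -eqn0Ngt /bar_count count_map => /eqP ->.
(* [J0] witnesses that the grid has points on both sides of [z]. *)
have [i iz imax] := @Order.TotalTheory.arg_maxP _ _ _ (itv_lo J0)
  (fun i => iota i <= z.1) id J0l.
have [j zj jmin] := @Order.TotalTheory.arg_minP _ _ _ (itv_hi J0)
  (fun j => z.2 <= iota j) id J0r.
have ij : (i < j)%O by rewrite -iota_lt (le_lt_trans iz) // (lt_le_trans zlt).
apply: leq_trans (rk (@Itv m.+2 (i, j) ij)); rewrite RankE /bar_count count_map.
apply: sub_count => J /= /andP[Jl Jr]; rewrite [(_ <= J)%O]itvs_leE.
by apply/andP; split; [exact: imax|exact: jmin].
Qed.

End Barcode.

Lemma count_sum_count_mem (T : finType) (P : pred T) (u : seq T) :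
  count P u = (\sum_(x : T | P x) count_mem x u)%N.
Proof.
elim: u => [|y u IH] /=; first by rewrite big1.
rewrite big_split /= -IH; congr (_ + _)%N.
rewrite -big_mkcondr /= (eq_bigl (fun x => (x == y) && P y)); last first.
  by move=> x; rewrite [y == x]eq_sym andbC; case: eqP => [->|].
case: (P y); last by rewrite big_pred0 // => x; rewrite andbF.
by rewrite (eq_bigl (pred1 y)) ?big_pred1_eq // => x; rewrite andbT.
Qed.

Lemma barcode_of_module (F : fieldType) m (M : pmod 'I_m.+1 F) :
  exists Bi : seq (itvs m.+2), forall I, Rank M I = count (fun J => (I <= J)%O) Bi.
Proof.
have [Bi BiP] := multiset_of_function (fun J => `|PD M J|%N) (enum_uniq {: itvs m.+2}).
exists Bi => I; apply/eqP; rewrite -eqz_nat -sum_PD count_sum_count_mem.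
rewrite (big_morph Posz PoszD (erefl _)); apply/eqP/eq_bigr => J _.
by rewrite BiP mem_enum gez0_abs // PD_ge0.
Qed.

Lemma bar_index_iota (R : realType) n (iota : 'I_n -> R) (a : R) (i : 'I_n) :
  {mono iota : i j / (i <= j)%O} -> iota i <= a ->
  (forall j, iota j <= a -> (j <= i)%O) -> bar_index iota a = Some i.
Proof.
move=> iota_le ia imax; rewrite /bar_index; case: pickP => [j|/(_ i)].
  move=> /andP[ja /forallP jmax]; congr Some; apply/le_anti.
  by rewrite imax //=; have := jmax i; rewrite ia.
by rewrite ia /=; case/negP; apply/forallP => j; apply/implyP; exact: imax.
Qed.

Lemma tp_iota_le (R : realType) (F : fieldType) (M : pmod R F)
  (p : tame_presentation M) : {mono @tp_iota _ _ _ p : i j / (i <= j)%O}.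
Proof.
apply: le_mono => i j ij; rewrite lt_neqAle (@tp_iota_mono _ _ _ p _ _ (ltW ij)) andbT.
by rewrite (inj_eq (@tp_iota_inj _ _ _ p)) (lt_eqF ij).
Qed.

Lemma rk_bar (R : realType) (F : fieldType) m (M : pmod 'I_m.+1 F)
    (iota : 'I_m.+2 -> R) (a b : R) : a <= b ->
  rk (bar M iota) a b =
  match bar_index iota a, bar_index iota b with
  | Some i, Some j => if (j < m.+1)%N then rk M (inord i) (inord j) else 0%N
  | _, _ => 0%N end.
Proof.
move=> ab; rewrite rk_ext0 //.
case ia : (bar_index iota a) => [i|] //; case ib : (bar_index iota b) => [j|] //.
by rewrite rk_hat // (bar_index_mono ab ia ib).
Qed.

Lemma Rank_tame (R : realType) (F : fieldType) (M : pmod R F)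
    (p : tame_presentation M) (I : itvs (tp_m p).+2) :
  exists a b (ab : (a <= b)%O), Rank (tp_mod p) I = pm_rank M ab.
Proof.
have lohi : (itv_lo I < itv_hi I)%N by have := itv_ends_lt I; rewrite ltEord.
have hi0 : (0 < itv_hi I)%N by exact: leq_ltn_trans lohi.
have him : ((itv_hi I).-1 < (tp_m p).+1)%N by rewrite -ltnS prednK.
pose j : 'I_(tp_m p).+2 := inord (itv_hi I).-1.
have jE : j = (itv_hi I).-1 :> nat by rewrite inordK // ltnW.
have idx i : bar_index (@tp_iota _ _ _ p) (@tp_iota _ _ _ p i) = Some i.
  apply: bar_index_iota => //; first exact: tp_iota_le.
  by move=> i'; rewrite tp_iota_le.
have ab : @tp_iota _ _ _ p (itv_lo I) <= @tp_iota _ _ _ p j.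
  by rewrite tp_iota_le leEord jE -ltnS prednK.
exists (@tp_iota _ _ _ p (itv_lo I)), (@tp_iota _ _ _ p j), ab.
rewrite -rkE (rk_iso _ _ (tp_iso p)) rk_bar // !idx jE him.
by rewrite /Rank -rkE.
Qed.

(** All that the two inequalities need to know about a tame module. The rank of
    the module at the images of indices equals that of its finite presentation,
    which transfers the bound [K]. *)
Lemma tame_barcode (R : realType) (F : fieldType) (M : pmod R F)
    (p : tame_presentation M) (K : nat) :
  (forall (a b : R) (ab : (a <= b)%O), (pm_rank M ab <= K)%N) ->
  exists B : seq (R * R),
    [/\ represents (persistence_diagram p) B, rank_le K B &
      forall k z, (0 < k)%N -> z.1 < z.2 ->
        graded_persistence_diagram p k z = graded_diagram k B z].
Proof.
move=> rkK; have [Bi BiP] := barcode_of_module (tp_mod p).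
exists (map (bar_pt (@tp_iota _ _ _ p)) Bi); split.
- exact (persistence_diagram_barcode (@tp_iota_le _ _ _ p) BiP).
- apply: (barcode_rank_le (@tp_iota_le _ _ _ p) BiP _) => I.
  by have [a [b [ab ->]]] := Rank_tame I.
- by move=> k z; exact: (graded_diagram_barcode (@tp_iota_le _ _ _ p) BiP).
Qed.
(** * Lower bounds by Lipschitz functions *)

Section LowerBounds.
Context {R : realType}.
Implicit Types (z w : R * R) (s t : seq ((R * R) * (R * R))) (phi : R * R -> R).

Definition lipschitz1 phi : Prop := forall z w, phi z - phi w <= l1_dist z w.

Lemma sum_off_diagonal phi (X Y : seq (R * R)) :
  (forall z, z.1 = z.2 -> phi z = 0) ->
  all (fun z => z.1 <= z.2) X -> all (fun z => z.1 <= z.2) Y ->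
  (forall z, z.1 < z.2 -> count_mem z X = count_mem z Y) ->
  \sum_(z <- X) phi z = \sum_(z <- Y) phi z.
Proof.
move=> phi0 vX vY XY; pose off z := z.1 < z.2.
have offE (Z : seq (R * R)) : all (fun z => z.1 <= z.2) Z ->
    \sum_(z <- Z) phi z = \sum_(z <- [seq z <- Z | off z]) phi z.
  move=> vZ; rewrite big_filter (bigID off) /= [X in _ + X]big1_seq ?addr0 //.
  move=> z /andP[zoff /(allP vZ) zle]; apply: phi0; apply/le_anti.
  by rewrite zle leNgt.
rewrite offE // [RHS]offE //; apply: perm_big; apply/allP => z _ /=.
rewrite !count_filter.
have [zlt|zge] := boolP (off z).
  rewrite (eq_count (a2 := pred1 z)); last by move=> w /=; case: eqP => [->|].
  rewrite [X in _ == X](eq_count (a2 := pred1 z)); last by move=> w /=; case: eqP => [->|].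
  by rewrite XY.
have no w : (w == z) && off w = false by case: eqP => [->|//]; exact: negbTE.
by rewrite !(eq_count (a2 := pred0) no) !count_pred0.
Qed.

(** Duality: integrating a 1-Lipschitz function that vanishes on the diagonal
    depends on the boundary only, so one list of moves computes the integral and
    all the others are at least as expensive. *)
Lemma kr_norm_lower phi (f : R * R -> int) t :
  lipschitz1 phi -> (forall z, z.1 = z.2 -> phi z = 0) -> transports t f ->
  ((\sum_(m <- t) (phi m.1 - phi m.2))%:E <= kr_norm f)%E.
Proof.
move=> lip phi0 [vt et]; apply: le_ereal_inf_tmp => _ [s [vs es] <-].
rewrite lee_fin (@le_trans _ _ (\sum_(m <- s) (phi m.1 - phi m.2))) //; last first.
  by apply: ler_sum => m _; exact: lip.
have vfst (u : seq ((R * R) * (R * R))) : valid_moves u ->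
    all (fun z => z.1 <= z.2) (map fst u).
  by move=> vu; rewrite all_map; apply: sub_all vu => m /= /andP[].
have vsnd (u : seq ((R * R) * (R * R))) : valid_moves u ->
    all (fun z => z.1 <= z.2) (map snd u).
  by move=> vu; rewrite all_map; apply: sub_all vu => m /= /andP[].
have := @sum_off_diagonal phi (map fst t ++ map snd s) (map fst s ++ map snd t) phi0.
rewrite !all_cat !vfst ?vsnd // => /(_ isT isT).
rewrite !big_cat !big_map /= !sumrB => e; rewrite lerBlDr addrAC lerBrDr e //.
move=> z zlt; have := es z zlt; rewrite et // /moves_boundary !count_cat.
by move: (count _ _) (count _ _) (count _ _) (count _ _); clear; lia.
Qed.

(** Separates [a] from all points at distance at least 1. *)
Definition tent a z : R := Num.max 0 (1 - l1_dist a z).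

Lemma tent_lipschitz a : lipschitz1 (tent a).
Proof.
move=> z w; have := l1_dist_triangle z a w; have := l1_dist_ge0 z w.
by rewrite /tent; case: (leP 0 (1 - l1_dist a z)) => h;
  case: (leP 0 (1 - l1_dist a w)) => h' ? ?; lra.
Qed.

Lemma tent_self a : tent a a = 1.
Proof. by rewrite /tent /l1_dist !subrr normr0 addr0 subr0 max_r. Qed.

Lemma tent_le1 a z : tent a z <= 1.
Proof. by rewrite /tent ge_max ler01 gerBl l1_dist_ge0. Qed.

Lemma tent_far a z : 1 <= l1_dist a z -> tent a z = 0.
Proof. by move=> h; rewrite /tent max_l // subr_le0. Qed.

Lemma tent_diagonal a z : a.1 + 1 <= a.2 -> z.1 = z.2 -> tent a z = 0.
Proof.
move=> a12 zd; apply: tent_far; rewrite /l1_dist zd.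
have := ler_norm (z.2 - a.1); have := ler_norm (a.2 - z.2).
by rewrite (distrC a.2) => ? ?; lra.
Qed.

Lemma max_lipschitz phi psi : lipschitz1 phi -> lipschitz1 psi ->
  lipschitz1 (fun z => Num.max (phi z) (psi z)).
Proof.
move=> lphi lpsi z w; have := lphi z w; have := lpsi z w.
by case: (leP (phi z)) => h; case: (leP (phi w)) => h' ? ?; lra.
Qed.

End LowerBounds.

(** * Direct sums of interval modules *)

Section IntervalModules.
Context (F : fieldType) (J : finType).
Implicit Types (A B C : {set J}).

(** The map from the free space on [A] to that on [B] which preserves the basis
    vectors of the intersection and kills the others. *)
Definition transfer_mx A B : 'M[F]_(#|A|, #|B|) :=
  \matrix_(i, j) (enum_val i == enum_val j)%:R.

Lemma transfer_mx1 A : transfer_mx A A = 1%:M.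
Proof. by apply/matrixP => i j; rewrite !mxE (inj_eq enum_val_inj). Qed.

Lemma transfer_mxM A B C : A :&: C \subset B ->
  transfer_mx A B *m transfer_mx B C = transfer_mx A C.
Proof.
move=> /fintype.subsetP ACB; apply/matrixP => i j; rewrite !mxE.
under eq_bigr do rewrite !mxE.
rewrite -(big_enum_val (A := mem B) (fun x => (enum_val i == x)%:R * (x == enum_val j)%:R)) /=.
have [iB|iB] := boolP (enum_val i \in B).
  rewrite (bigD1 (enum_val i)) //= eqxx mul1r big1 ?addr0 // => x /andP[_ xi].
  by rewrite eq_sym (negbTE xi) mul0r.
rewrite big1 => [|x xB].
  case: eqP => // ij; case/negP: iB; apply: ACB.
  by rewrite inE enum_valP ij enum_valP.
by case: eqP => [ix|_]; rewrite ?mul0r //; rewrite ix xB in iB.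
Qed.

Definition transfer A B : 'Hom('rV[F]_#|A|, 'rV[F]_#|B|) :=
  linfun (mulmxr (transfer_mx A B)).

Lemma transfer1 A : transfer A A = \1%VF.
Proof. by apply/lfunP => v; rewrite lfunE /= transfer_mx1 mulmx1 id_lfunE. Qed.

Lemma transfer_comp A B C : A :&: C \subset B ->
  transfer A C = (transfer B C \o transfer A B)%VF.
Proof.
move=> ACB; apply/lfunP => v.
by rewrite comp_lfunE !lfunE /= -mulmxA transfer_mxM.
Qed.

(** The map factors through the space on the intersection, as a surjection
    followed by an injection. *)
Lemma dim_transfer A B : \dim (limg (transfer A B)) = #|A :&: B|.
Proof.
set I := A :&: B.
have surj : limg (transfer A I) = fullv.
  apply/vspaceP => v; rewrite memvf.
  have -> : v = transfer A I (transfer I A v); last by rewrite memv_img // memvf.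
  rewrite -comp_lfunE -transfer_comp ?transfer1 ?id_lfunE //.
  by rewrite finset.setIid finset.subsetIl.
have inj : lker (transfer I B) = 0%VS.
  apply/eqP/lker0P => u v uv.
  rewrite -[u]id_lfunE -[v]id_lfunE -transfer1 (@transfer_comp I B I) ?comp_lfunE ?uv //.
  by rewrite finset.setIid finset.subsetIr.
rewrite (@transfer_comp A I B) // limg_comp surj limg_dim_eq ?inj ?capv0 //.
by rewrite dimvf /dim /= mul1n.
Qed.

Variables (m : nat) (bi : J -> itvs m.+2).

(** The indices of the intervals that contain [a]. *)
Definition alive (a : nat) : {set J} := [set j | itv_lo (bi j) <= a < itv_hi (bi j)]%N.

Lemma alive_conv (a b c : nat) : (a <= b)%N -> (b <= c)%N ->
  alive a :&: alive c \subset alive b.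
Proof.
move=> ab bc; apply/fintype.subsetP => j; rewrite !inE.
move=> /andP[/andP[la _] /andP[_ ch]].
by rewrite (leq_trans la ab) (leq_ltn_trans bc ch).
Qed.

Definition interval_module : pmod 'I_m.+1 F :=
  @PMod _ 'I_m.+1 F (fun a => 'rV[F]_#|alive a|)
    (fun a b _ => transfer (alive a) (alive b))
    (fun a _ => transfer1 (alive a))
    (fun a b c ab bc _ => transfer_comp (alive_conv ab bc)).

Lemma rk_interval_module (a b : 'I_m.+1) : (a <= b)%O ->
  rk interval_module a b = #|alive a :&: alive b|.
Proof. by move=> ab; rewrite (rkE _ ab) /pm_rank dim_transfer. Qed.

Lemma Rank_interval_module (I : itvs m.+2) :
  Rank interval_module I = count (fun L => (I <= L)%O) [seq bi j | j <- enum J].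
Proof.
have lohi : (itv_lo I < itv_hi I)%N by have := itv_ends_lt I; rewrite ltEord.
have hi0 : (0 < itv_hi I)%N by exact: leq_ltn_trans lohi.
have him : ((itv_hi I).-1 < m.+1)%N by rewrite -ltnS prednK.
have lom : (itv_lo I < m.+1)%N by apply: leq_ltn_trans him; rewrite -ltnS prednK.
rewrite /Rank -rkE rk_interval_module; last exact: itv_inord_le.
rewrite !inordK // count_map cardE {1}/enum_mem size_filter -enumT.
apply: eq_count => j /=; rewrite [RHS]itvs_leE !leEord !inE.
have [lo_le|] /= := leqP (itv_lo (bi j)) (itv_lo I); last by [].
rewrite (leq_trans lo_le) ?andTb; last by rewrite -ltnS prednK.
rewrite [X in _ && X](_ : _ = (itv_hi I <= itv_hi (bi j))%N); last by rewrite -[in RHS](prednK hi0).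
by apply/andb_idl => /(leq_trans lohi).
Qed.

End IntervalModules.
(** * Examples of equality *)

Section TamePresentations.
Context (F : fieldType) (R : realType).

Lemma pm_iso_refl (d : Order.disp_t) (P : porderType d) (M : pmod P F) : pm_iso M M.
Proof.
exists (fun a => \1%VF); split=> [a|a b ab]; last by rewrite comp_lfun1r comp_lfun1l.
by exists (\1%VF : 'End(M a)) => v; rewrite !id_lfunE.
Qed.

Context (J : finType) (m : nat) (bi : J -> itvs m.+2).

Definition grid (i : 'I_m.+2) : R := (i : nat)%:R.

Lemma grid_le : {mono grid : i j / (i <= j)%O}.
Proof. by move=> i j; rewrite /grid ler_nat leEord. Qed.

Lemma grid_inj : injective grid.
Proof. exact: inc_inj grid_le. Qed.

Lemma grid_homo : {homo grid : i j / (i <= j)%O >-> (i <= j)%O}.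
Proof. by move=> i j; rewrite grid_le. Qed.

Definition interval_presentation :
    tame_presentation (bar (interval_module F bi) grid) :=
  TamePresentation grid_inj grid_homo (pm_iso_refl _).

Let M := bar (interval_module F bi) grid.
Let B := map (bar_pt grid) [seq bi j | j <- enum J].

Lemma interval_presentation_diagram :
  represents (persistence_diagram interval_presentation) B.
Proof. exact (persistence_diagram_barcode grid_le (Rank_interval_module F bi)). Qed.

Lemma interval_presentation_graded k z : (0 < k)%N -> z.1 < z.2 ->
  graded_persistence_diagram interval_presentation k z = graded_diagram k B z.
Proof. exact: (graded_diagram_barcode grid_le (Rank_interval_module F bi)). Qed.

Lemma interval_barcode_rank_le : rank_le #|J| B.
Proof.
move=> z _; by apply: leq_trans (count_size _ _) _; rewrite size_map size_map -cardT.
Qed.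

Lemma interval_rank_le (a b : R) (ab : (a <= b)%O) : (pm_rank M ab <= #|J|)%N.
Proof.
rewrite -rkE rk_bar //; case ia : bar_index => [i|] //; case ib : bar_index => [j|] //.
case: ifP => // jm; rewrite rk_interval_module ?max_card //.
have ij : (i <= j)%N := bar_index_mono ab ia ib.
by rewrite leEord !inordK // (leq_ltn_trans ij).
Qed.

Lemma interval_rank_max (i : 'I_m.+2) :
  (i < m.+1)%N -> (forall j, itv_lo (bi j) <= i < itv_hi (bi j))%N ->
  exists a b (ab : (a <= b)%O), pm_rank M ab = #|J|.
Proof.
move=> im all_alive; exists (grid i), (grid i), (lexx _).
have idx : bar_index grid (grid i) = Some i.
  by apply: bar_index_iota grid_le _ _ => // j; rewrite grid_le.
rewrite -rkE rk_bar // idx im rk_interval_module // finset.setIid inordK //.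
rewrite -cardsT; congr #|pred_of_set _|; apply/setP => j.
by rewrite !inE all_alive.
Qed.

End TamePresentations.

Definition nat_itv (n a b : nat) (ab : (a < b)%N) (bn : (b < n)%N) : itvs n :=
  @Itv n (Ordinal (ltn_trans ab bn), Ordinal bn) ab.

Section LowerSharp.
Context (F : fieldType) (R : realType).

Definition unit_bars n (j : 'I_n) : itvs 2 := @nat_itv 2 0 1 isT isT.

Lemma unit_bars_barcode n :
  map (bar_pt (@grid R 0)) [seq unit_bars j | j <- enum 'I_n] = nseq n (0, 1).
Proof.
rewrite -map_comp (eq_map (g := fun=> (0, 1))) => [|j].
  by rewrite -[in RHS](size_enum_ord n); elim: (enum _) => //= ? s ->.
by rewrite /= /bar_pt /grid /=.
Qed.

Lemma graded_nseq n k (p z : R * R) : (0 < k <= n)%N ->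
  graded_diagram k (nseq n p) z = (count_mem z [:: p])%:Z.
Proof.
move=> /andP[k0 kn]; rewrite count_mem_bar_count /graded_diagram /bar_count /= !addn0.
rewrite !count_nseq.
have e (b : bool) : (k <= b * n)%N = b by case: b; rewrite ?mul1n ?mul0n // leqNgt k0.
by rewrite !e.
Qed.

(** Every graded diagram of the first module is the point (0, 1), at distance 1 from the diagonal,
    and the length of intervals is a 1-Lipschitz function that forces [K] copies
    of it to cost [K]. *)
Lemma lower_bound_sharp K : (1 <= K)%N ->
  exists (M N : pmod R F) (p : tame_presentation M) (q : tame_presentation N),
    let D := persistence_diagram p in
    let E := persistence_diagram q in
    let Dk := graded_persistence_diagram p in
    let Ek := graded_persistence_diagram q in
    [/\ is_max_rank M N K, (0 < W11 D E)%E &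
      (W11 D E = \sum_(1 <= k < K.+1) W11_signed (Dk k) (Ek k))%E].
Proof.
move=> K0; pose bi := @unit_bars K; pose bi0 := @unit_bars 0.
exists _, _, (interval_presentation F R bi), (interval_presentation F R bi0) => D E Dk Ek.
have repD : represents D (nseq K (0, 1)).
  by rewrite -unit_bars_barcode; exact: interval_presentation_diagram.
have repE : represents E (nseq 0 (0, 1)).
  by rewrite -unit_bars_barcode; exact: interval_presentation_diagram.
have gD k z : (0 < k)%N -> z.1 < z.2 -> Dk k z = graded_diagram k (nseq K (0, 1)) z.
  by rewrite -unit_bars_barcode; exact: interval_presentation_graded.
have gE k z : (0 < k)%N -> z.1 < z.2 -> Ek k z = graded_diagram k (nseq 0 (0, 1)) z.
  by rewrite -unit_bars_barcode; exact: interval_presentation_graded.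
have rkD : rank_le K (nseq K ((0, 1) : R * R)).
  by rewrite -[K in rank_le K]card_ord -unit_bars_barcode; exact: interval_barcode_rank_le.
have rkE : rank_le K (nseq 0 ((0, 1) : R * R)) by [].
have ltW11 : (K%:R%:E <= W11 D E)%E.
  rewrite (W11_kr_norm repD repE).
  pose phi (z : R * R) := Num.max 0 (z.2 - z.1).
  have lip : lipschitz1 phi.
    move=> z w; rewrite /phi /l1_dist.
    have := ler_norm (w.1 - z.1); have := ler_norm (z.2 - w.2).
    rewrite (distrC z.2) => h1 h2; have := normr_ge0 (w.1 - z.1); have := normr_ge0 (w.2 - z.2).
    by case: (leP 0 (z.2 - z.1)) => h; case: (leP 0 (w.2 - w.1)) => h' ? ?; lra.
  have phi0 z : z.1 = z.2 -> phi z = 0 by move=> e; rewrite /phi e subrr maxxx.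
  pose t := nseq K (((0, 1), (0, 0)) : (R * R) * (R * R)).
  have trt : transports t (fun z => D z - E z).
    split; first by rewrite /valid_moves /t all_nseq /= lexx ler01 orbT.
    move=> z zlt; rewrite repD // repE // /moves_boundary /t !map_nseq /= subr0.
    rewrite [X in _ - Posz X](_ : _ = 0%N) ?subr0 //.
    rewrite count_nseq /=; case: eqP => // e.
    by move: zlt; rewrite -e ltxx.
  apply: le_trans (kr_norm_lower lip phi0 trt).
  rewrite lee_fin /t big_nseq /= iter_addr_0 {1}/phi /= subr0 (max_r ler01).
  by rewrite /phi subrr maxxx subr0.
have le_sum : (\sum_(1 <= k < K.+1) W11_signed (Dk k) (Ek k) <= K%:R%:E)%E.
  rewrite big_add1 /= big_mkord.
  apply: (@le_trans _ _ (\sum_(k < K) 1%:E)%E); last first.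
    by rewrite sumEFin sumr_const card_ord.
  apply: lee_sum => k _; rewrite (W11_signed_graded gD gE) //.
  have trt : transports [:: (((0, 1), (0, 0)) : (R * R) * (R * R))]
      (fun z => graded_diagram k.+1 (nseq K (0, 1)) z - graded_diagram k.+1 (nseq 0 (0, 1)) z).
    split; first by rewrite /valid_moves /= lexx ler01.
    move=> z zlt; rewrite graded_nseq; last exact: ltn_ord.
    rewrite /moves_boundary /graded_diagram /= subr0.
    have -> : ((0, 0) == z) = false by apply/eqP => e; move: zlt; rewrite -e ltxx.
    exact/esym/subr0.
  apply: le_trans (kr_norm_le trt) _.
  rewrite lee_fin /moves_cost big_seq1 /l1_dist /= subrr normr0 add0r sub0r.
  by rewrite normrN normr1.
have := W11_le_sum_graded repD repE rkD rkE gD gE => le1.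
split.
- split; last first.
    move=> a b ab; have := interval_rank_le F bi ab; have := interval_rank_le F bi0 ab.
    by rewrite !card_ord leqn0 => /eqP ->.
  have [a [b [ab e]]] := @interval_rank_max F R _ _ bi ord0 isT (fun=> isT).
  by exists a, b, ab; left; rewrite e card_ord.
- by apply: lt_le_trans ltW11; rewrite lte_fin ltr0n.
- by apply/eqP; rewrite eq_le le1 (le_trans le_sum).
Qed.

End LowerSharp.

(** In this part the rank is [K.+1]. *)
Section UpperSharp.
Context (F : fieldType) (R : realType) (K : nat).

Lemma stair_ltn (j : 'I_K.+1) : (1 < K.+2 - j)%N.
Proof. by have := ltn_ord j; lia. Qed.

Lemma stair_lt_ord (j : 'I_K.+1) : (K.+2 - j < K.+3)%N.
Proof. by lia. Qed.

(** Bars with common left end 0 and right ends K + 2, ..., 2. *)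
Definition stair_bars (j : 'I_K.+1) : itvs K.+3 :=
  nat_itv (ltnW (stair_ltn j)) (stair_lt_ord j).

Lemma moved_ltn (j : 'I_K.+1) : ((j == ord0) < K.+2 - j)%N.
Proof. by apply: leq_ltn_trans (leq_b1 _) (stair_ltn j). Qed.

(** Only the longest bar, of index 0, starts at 1 instead of 0. *)
Definition moved_bars (j : 'I_K.+1) : itvs K.+3 :=
  nat_itv (moved_ltn j) (stair_lt_ord j).

Definition short_stairs : seq (R * R) :=
  [seq (0, (K.+1 - i)%:R) | i <- iota 0 K].

Lemma stair_barcode : map (bar_pt (@grid R _)) [seq stair_bars j | j <- enum 'I_K.+1] =
  (0, K.+2%:R) :: short_stairs.
Proof.
rewrite enum_ordSl /= -2!map_comp /short_stairs -val_enum_ord -[in RHS]map_comp.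
by congr (_ :: _); apply: eq_map => i; rewrite /= /bar_pt /grid /= lift0 subSS.
Qed.

Lemma moved_barcode : map (bar_pt (@grid R _)) [seq moved_bars j | j <- enum 'I_K.+1] =
  (1, K.+2%:R) :: short_stairs.
Proof.
rewrite enum_ordSl /= -2!map_comp /short_stairs -val_enum_ord -[in RHS]map_comp.
by congr (_ :: _); apply: eq_map => i; rewrite /= /bar_pt /grid /= lift0 subSS.
Qed.

Lemma count_antitone (P : pred nat) n j :
  (forall i i', (i <= i')%N -> P i' -> P i) ->
  (j < count P (iota 0 n))%N = (j < n)%N && P j.
Proof.
move=> Panti; elim: n => [|n IH]; first by [].
rewrite -[in iota _ _]addn1 iotaD count_cat /= addn0.
have [Pn|nPn] := boolP (P n).
  have /eqP -> : count P (iota 0 n) == size (iota 0 n).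
    rewrite -all_count; apply/allP => i; rewrite mem_iota add0n => /andP[_ /ltnW iltn].
    exact: Panti iltn Pn.
  rewrite size_iota /= addn1 ltnS.
  by case: leqP => // jn; rewrite (Panti _ _ jn Pn).
rewrite addn0 IH ltnS [in RHS]leq_eqVlt.
by case: eqP => [->|//]; rewrite (negbTE nPn) ltnn.
Qed.

(** The thresholds for moving the longest bar. The last one that differs from 0
    is 2, so that both ends of the moves stay at distance 1 from the diagonal. *)
Definition stair_height (j : nat) : R := if (j <= K)%N then (K.+2 - j)%:R else 0.

Lemma stair_height_ge0 j : 0 <= stair_height j.
Proof. by rewrite /stair_height; case: ifP. Qed.

Lemma stair_heightP j d (b : R) : 0 < b ->
  (b < K.+2%:R ?<= if d) && (j <= bar_count true d short_stairs (0%R, b))%N =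
  (b < stair_height j ?<= if d).
Proof.
move=> b0; case: j => [|j]; first by rewrite /stair_height subn0 andbT.
rewrite /bar_count count_map.
rewrite (eq_count (a2 := fun i => b < (K.+1 - i)%:R ?<= if d)); last first.
  by move=> i /=; rewrite lexx.
have mono (i i' : nat) : (i <= i')%N ->
    (b < i%:R ?<= if d) -> (b < i'%:R ?<= if d).
  move=> ii'; have : i%:R <= i'%:R :> R by rewrite ler_nat.
  by case: d => /= h1 h2; [exact: le_trans h1|exact: lt_le_trans h1].
rewrite count_antitone => [|i i' ii']; last by apply: mono; exact: leq_sub2l.
rewrite /stair_height subSS; case: ltnP => /= jK.
  by apply/andb_idl; apply: mono; rewrite leqW // leq_subr.
rewrite andbF; apply/esym/negbTE/negP => /lteifW.
by rewrite leNgt b0.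
Qed.

(** How the diagram of level [k.+1] changes when the longest bar moves. *)
Definition stair_gap (k : nat) (z : R * R) : int :=
  graded_diagram k.+1 ((0, K.+2%:R) :: short_stairs) z
  - graded_diagram k.+1 ((1, K.+2%:R) :: short_stairs) z.

(** The two sources of mass are at distance at least 1 from the two targets and
    from the diagonal, so each costs at least 1. At the top level there is only
    one source. *)
Lemma kr_norm_stair_ge k : (k <= K)%N ->
  ((if (k == K)%N then 1 else 2)%:E <= kr_norm (stair_gap k))%E.
Proof.
move=> kK; set t := stair_height.
have tr : transports (strip_moves 0 1 t k) (stair_gap k).
  apply: strip_transports; first exact: ler01.
  - by move=> p /mapP[i _ ->] /=; rewrite ltxx.
  - exact: stair_height_ge0.
  - by move=> j d b b0; exact: stair_heightP.
have tk : 2 <= t k by rewrite /t /stair_height kK (ler_nat _ 2); lia.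
have l1E (a b c e : R) : l1_dist (a, b) (c, e) = `|c - a| + `|e - b| by [].
case: eqP => [kE|/eqP kE].
  have tk1 : t k.+1 = 0 by rewrite /t /stair_height kE ltnn.
  have diag0 z : z.1 = z.2 -> tent (0, t k) z = 0.
    by apply: tent_diagonal => /=; lra.
  apply: le_trans (kr_norm_lower (@tent_lipschitz _ (0, t k)) diag0 tr).
  rewrite lee_fin /strip_moves tk1 (min_l (_ : 1 <= t k)); last by lra.
  rewrite (min_r ler01) !big_cons big_nil /= subrr tent_self tent_far ?addr0 ?subr0 //.
  by rewrite l1E subr0 normr1 lerDl.
have tk1 : t k = t k.+1 + 1.
  rewrite /t /stair_height kK ltn_neqAle kE kK natr1; congr _%:R; lia.
have tk2 : 2 <= t k.+1.
  by rewrite /t /stair_height ltn_neqAle kE kK (ler_nat _ 2); move/eqP: kE; lia.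
pose A := (0 : R, t k); pose C := (1 : R, t k.+1).
pose phi z := Num.max (tent A z) (tent C z).
have lip : lipschitz1 phi by apply: max_lipschitz; exact: tent_lipschitz.
have diag0 z : z.1 = z.2 -> phi z = 0.
  by move=> zd; rewrite /phi !tent_diagonal ?maxxx //=; lra.
apply: le_trans (kr_norm_lower lip diag0 tr).
rewrite lee_fin /strip_moves (min_l (_ : 1 <= t k)); last by lra.
rewrite (min_l (_ : 1 <= t k.+1)); last by lra.
rewrite !big_cons big_nil /= addr0.
have phiA : phi A = 1 by rewrite /phi tent_self max_l // tent_le1.
have phiC : phi C = 1 by rewrite /phi tent_self max_r // tent_le1.
have phi1 : phi (1, t k) = 0.
  rewrite /phi !tent_far ?maxxx // l1E.
    by rewrite subrr normr0 add0r tk1 addrAC subrr add0r normr1.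
  by rewrite subr0 normr1 lerDl.
have phi2 : phi (0, t k.+1) = 0.
  rewrite /phi !tent_far ?maxxx // l1E.
    by rewrite sub0r normrN normr1 lerDl.
  by rewrite subrr normr0 add0r tk1 opprD addrA subrr sub0r normrN normr1.
by rewrite -/A -/C phiA phiC phi1 phi2 !subr0.
Qed.

Lemma upper_bound_sharp :
  exists (M N : pmod R F) (p : tame_presentation M) (q : tame_presentation N),
    let D := persistence_diagram p in
    let E := persistence_diagram q in
    let Dk := graded_persistence_diagram p in
    let Ek := graded_persistence_diagram q in
    [/\ is_max_rank M N K.+1, (0 < W11 D E)%E &
      (\sum_(1 <= k < K.+2) W11_signed (Dk k) (Ek k)
        = (2 * K.+1%:R - 1)%:E * W11 D E)%E].
Proof.
exists _, _, (interval_presentation F R stair_bars), (interval_presentation F R moved_bars).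
move=> D E Dk Ek.
pose B := ((0, K.+2%:R) :: short_stairs); pose B' := ((1, K.+2%:R) :: short_stairs).
have repD : represents D B.
  by rewrite /B -stair_barcode; exact: interval_presentation_diagram.
have repE : represents E B'.
  by rewrite /B' -moved_barcode; exact: interval_presentation_diagram.
have gD k z : (0 < k)%N -> z.1 < z.2 -> Dk k z = graded_diagram k B z.
  by rewrite /B -stair_barcode; exact: interval_presentation_graded.
have gE k z : (0 < k)%N -> z.1 < z.2 -> Ek k z = graded_diagram k B' z.
  by rewrite /B' -moved_barcode; exact: interval_presentation_graded.
have rkD : rank_le K.+1 B.
  by rewrite -[K.+1]card_ord /B -stair_barcode; exact: interval_barcode_rank_le.
have rkE : rank_le K.+1 B'.
  by rewrite -[K.+1]card_ord /B' -moved_barcode; exact: interval_barcode_rank_le.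
have W1 : (W11 D E <= 1)%E.
  rewrite (W11_kr_norm repD repE).
  have tr : transports [:: ((0, K.+2%:R), (1, K.+2%:R))] (fun z => D z - E z).
    split; first by rewrite /valid_moves /= ler0n (ler_nat _ 1).
    move=> z zlt; rewrite repD // repE // /moves_boundary /= !addn0 !PoszD.
    by rewrite opprD addrACA subrr addr0.
  apply: le_trans (kr_norm_le tr) _.
  rewrite lee_fin /moves_cost big_seq1 /l1_dist /= subrr normr0 addr0 subr0.
  by rewrite normr1.
set c := 2 * K.+1%:R - 1.
have c0 : 0 < c :> R.
  by rewrite /c subr_gt0; have : 1 <= K.+1%:R :> R; [rewrite (ler_nat _ 1)|lra].
have sum_ge : (c%:E <= \sum_(1 <= k < K.+2) W11_signed (Dk k) (Ek k))%E.
  rewrite big_add1 /= big_mkord.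
  apply: (@le_trans _ _ (\sum_(k < K.+1) (if (k == K :> nat) then 1 else 2)%:E)%E).
    rewrite sumEFin lee_fin big_ord_recr /= eqxx.
    rewrite (eq_bigr (fun=> 2)) => [|k _]; last by rewrite ltn_eqF.
    by rewrite sumr_const card_ord /c -[K.+1]addn1 natrD -[2 *+ K]mulr_natr; lra.
  apply: lee_sum => k _; rewrite (W11_signed_graded gD gE) //.
  by apply: kr_norm_stair_ge; rewrite -ltnS.
have sum_le := sum_graded_le_W11 repD repE rkD rkE gD gE.
have cW_le : (c%:E * W11 D E <= c%:E)%E.
  by rewrite -[leRHS]mule1 lee_pmul2l // lte_fin.
split.
- split; last first.
    move=> a b ab; have := interval_rank_le F stair_bars ab.
    by have := interval_rank_le F moved_bars ab; rewrite !card_ord.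
  have [a [b [ab e]]] := @interval_rank_max F R _ _ stair_bars ord0 isT
    (fun j => ltnW (stair_ltn j)).
  by exists a, b, ab; left; rewrite e card_ord.
- rewrite ltNge; apply/negP => W0.
  have := le_trans sum_ge sum_le; rewrite leNgt => /negP; apply.
  apply: le_lt_trans (_ : 0 < c%:E)%E; last by rewrite lte_fin.
  by rewrite mule_ge0_le0 // lee_fin ltW.
- by apply/eqP; rewrite eq_le sum_le (le_trans cW_le).
Qed.

End UpperSharp.

(** * Conclusion *)

Theorem theorem6p15 (F : fieldType) (R : realType) :
  (forall (M N : pmod R F) (p : tame_presentation M) (q : tame_presentation N)
      (K : nat),
    is_max_rank M N K ->
    let D := persistence_diagram p in
    let E := persistence_diagram q in
    let Dk := graded_persistence_diagram p in
    let Ek := graded_persistence_diagram q in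
    (W11 D E <= \sum_(1 <= k < K.+1) W11_signed (Dk k) (Ek k))%E /\
    (\sum_(1 <= k < K.+1) W11_signed (Dk k) (Ek k)
      <= (2 * K%:R - 1)%:E * W11 D E)%E) /\
  (forall K : nat, (1 <= K)%N ->
    (exists (M N : pmod R F)
        (p : tame_presentation M) (q : tame_presentation N),
      let D := persistence_diagram p in
      let E := persistence_diagram q in
      let Dk := graded_persistence_diagram p in
      let Ek := graded_persistence_diagram q in
      [/\ is_max_rank M N K, (0 < W11 D E)%E &
        (W11 D E = \sum_(1 <= k < K.+1) W11_signed (Dk k) (Ek k))%E]) /\
    (exists (M N : pmod R F)
        (p : tame_presentation M) (q : tame_presentation N),
      let D := persistence_diagram p in
      let E := persistence_diagram q in
      let Dk := graded_persistence_diagram p in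
      let Ek := graded_persistence_diagram q in
      [/\ is_max_rank M N K, (0 < W11 D E)%E &
        (\sum_(1 <= k < K.+1) W11_signed (Dk k) (Ek k)
          = (2 * K%:R - 1)%:E * W11 D E)%E])).
Proof.
split=> [M N p q K [_ rk_max] D E Dk Ek|K K0].
  have [B [repD rkB gD]] := tame_barcode p (fun a b ab => (rk_max a b ab).1).
  have [B' [repE rkB' gE]] := tame_barcode q (fun a b ab => (rk_max a b ab).2).
  by split; [exact: W11_le_sum_graded gD gE|exact: sum_graded_le_W11 gD gE].
split; first exact: lower_bound_sharp.
by case: K K0 => // K _; exact: upper_bound_sharp.
Qed.
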